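(* Let $(X,\mathrm{d}\mu)$ be a $\sigma$-finite measure space and let $Y_1,\dots,Y_d$ be measure spaces. Let $\alpha_j>0$ with $\sum_{j=1}^d\alpha_j=1$, let $q\ge 2$, and let $2\le r_j<\infty$ for $1\le j\le d$. Let $T_j:\mathcal{S}(Y_j)\to\mathcal{M}(X)$ be linear operators, each of which saturates $X$. Suppose that $$\Big\|\prod_{j=1}^d|T_jf_j|^{\alpha_j}\Big\|_{L^q(X)}\le B\prod_{j=1}^d\|f_j\|_{L^{r_j}(Y_j)}^{\alpha_j}$$ for all simple functions $f_j\in\mathcal{S}(Y_j)$, $1\le j\le d$. Then there is a finite constant $C$, depending only on the exponents $q$ and $\{\alpha_j,r_j\}_{j=1}^d$, such that for every nonnegative $G\in L^{(q/2)'}(X)$ there exist nonnegative measurable functions $g_1,\dots,g_d$ on $X$ such that $$\prod_{j=1}^d g_j(x)^{\alpha_j}\ge G(x)\quad\text{for a.e. } x\in X,$$ and such that for each $j$, $$\left(\int_X|T_jf_j(x)|^2g_j(x)\,\mathrm{d}\mu(x)\right)^{1/2}\le C B\,\|G\|_{L^{(q/2)'}(X)}^{1/2}\,\|f_j\|_{L^{r_j}(Y_j)}\quad\text{for all } f_j\in\mathcal{S}(Y_j).$$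
   Context: $\mathcal{M}(X)$ is the class of measurable functions on $X$. $\mathcal{S}(Y_j)$ is the space of simple functions on $Y_j$ (with finite norm), equipped with the $L^{r_j}(Y_j)$-norm. A linear map $T:\mathcal{Y}\to\mathcal{M}(X)$ saturates $X$ if for each measurable $E\subseteq X$ of positive measure there exist a measurable $E'\subseteq E$ with $\mu(E')>0$ and an $h\in\mathcal{Y}$ such that $|Th|>0$ a.e. on $E'$. $(q/2)'$ is the conjugate exponent of $q/2$, that is, $1/(q/2)+1/(q/2)'=1$ (so it is $\infty$ when $q=2$). *)

(* Defs.v *)
From HB Require Import structures.
From mathcomp Require Import all_boot all_order all_algebra.
From mathcomp Require Import all_classical all_reals all_analysis.
From mathcomp Require Import complex.

Set Implicit Arguments.
Unset Strict Implicit.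
Unset Printing Implicit Defensive.

Import Order.TTheory GRing.Theory Num.Theory.
Import numFieldNormedType.Exports.

Local Open Scope classical_set_scope.
Local Open Scope ring_scope.

(* Functions and linear operators may be over the real or the complex field;
   both cases are covered. *)
Variant scalars := RealScalars | ComplexScalars.

Definition scalar_field (R : realType) (k : scalars) : fieldType :=
  match k with
  | RealScalars => R
  | ComplexScalars => R[i]
  end.

(* Valued in R, whereas the library norm on R[i] is valued in R[i]. *)
Definition modulus (R : realType) (k : scalars) : scalar_field R k -> R :=
  match k return scalar_field R k -> R with
  | RealScalars => fun x : R => `|x|
  | ComplexScalars => fun z : R[i] => Normc.normc z
  end.

Definition measurable_scalar_fun (R : realType) (k : scalars)
    (dX : measure_display) (X : measurableType dX) : set (X -> scalar_field R k) :=
  match k return set (X -> scalar_field R k) with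
  | RealScalars => fun f : X -> R => measurable_fun setT f
  | ComplexScalars => fun f : X -> R[i] =>
      measurable_fun setT (fun x => complex.Re (f x)) /\
      measurable_fun setT (fun x => complex.Im (f x))
  end.

Section operators.
Context (R : realType) (k : scalars).
Local Notation K := (scalar_field R k).

Definition lpnorm (dY : measure_display) (Y : measurableType dY)
    (nu : {measure set Y -> \bar R}) (r : \bar R) (f : Y -> K) : \bar R :=
  Lnorm nu r (fun y => (modulus (f y))%:E).

Definition simple_functions (dY : measure_display) (Y : measurableType dY)
    (nu : {measure set Y -> \bar R}) (r : \bar R) : set (Y -> K) :=
  [set f | [/\ measurable_scalar_fun f, finite_set (range f) &
               (lpnorm nu r f < +oo)%E]].

Context (dX : measure_display) (X : measurableType dX).
Variable mu : {measure set X -> \bar R}.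

(* T is a total function on Y -> K, of which only the values on the subspace S
   are meaningful. Measurable functions on X are considered up to a.e.
   equality, so linearity is only required almost everywhere. *)
Definition linear_operator (Y : Type) (S : set (Y -> K))
    (T : (Y -> K) -> (X -> K)) : Prop :=
  (forall f, S f -> measurable_scalar_fun (T f)) /\
  (forall (a : K) f g, S f -> S g ->
     {ae mu, forall x, T (fun y => a * f y + g y) x = a * T f x + T g x}).

Definition saturates (Y : Type) (S : set (Y -> K))
    (T : (Y -> K) -> (X -> K)) : Prop :=
  forall E : set X, measurable E -> (0 < mu E)%E ->
    exists E' : set X, [/\ measurable E', E' `<=` E, (0 < mu E')%E &
      exists2 h, S h & {ae mu, forall x, E' x -> 0 < modulus (T h x)}].

End operators.

(* Main.v *)
Require Import Defs.
From HB Require Import structures.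
From mathcomp Require Import all_boot all_order all_algebra.
From mathcomp Require Import all_classical all_reals all_analysis.
From mathcomp Require Import measurable_realfun ess_sup_inf complex ring lra.

(** The weights are dual objects, and they are found by convex duality. For a
    tuple a = (a_j) with each a_j in the unit ball of S(Y_j), put
    F_j^a = |T_j a_j|^2. It suffices to find g with prod_j g_j^(alpha_j) >= G
    and alpha_j * int F_j^a g_j <= 8 M for all a and j, where M is a constant
    times B^2 ||G||: scaling then gives the estimate for every f_j
    ([weighted_bound_homogeneous]).

    The first step replaces single functions by square functions: for convex
    weights w_i, int G prod_j (sum_i w_i F_j^(a_i))^(alpha_j) <= M
    ([square_function_bound]). Beyond homogeneity, linearity enters only here.
    Apply the hypothesis to the combinations sum_i +- sqrt(w_i) a_i with signs
    chosen at random, independently for each j. On the X side Khintchine's lower inequality bounds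
    the square functions by the average over the signs; for each choice of signs
    Hoelder's inequality with the exponent q/2 >= 1 applies; on the Y_j side
    Khintchine's upper inequality and Jensen's inequality, which needs r_j >= 2,
    show that the random combinations have bounded norm on average.

    The second step treats finitely many tuples ([near_optimizer_weights]). The
    map F |-> int G prod_j F_j^(alpha_j) is concave and homogeneous of degree 1.
    If a convex combination F of the F^(a_i) maximises it, the first-order
    conditions say that g_j = G prod_i F_i^(alpha_i) / F_j satisfies
    sum_j alpha_j int F_j^(a_i) g_j <= M for all i, and prod_j g_j^(alpha_j) = G
    holds wherever all F_j are positive. A near-maximiser whose coefficients are
    bounded below does as well, up to the factor 8, and exists without any compactness.

    The third step passes to all tuples at once. The constraints on g are convex
    and survive limits almost everywhere, by Fatou's lemma and the continuity of
    the geometric mean, and any finitely many of them can be met. Minimising the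
    strictly convex energy int sum_j exp(- g_j) under more and more constraints
    produces one limit for all of them ([convex_fip_ae_limit]). Two defects
    remain: the limit could be infinite somewhere, and a tuple a says nothing
    about G at the points where some F_j^a vanishes. Since every set of positive
    measure has a part of positive measure on which some tuple has all F_j^a > 0
    ([joint_saturation]), both occur on null sets only ([factorizing_weights]). *)

Set Implicit Arguments.
Unset Strict Implicit.
Unset Printing Implicit Defensive.

Import Order.TTheory GRing.Theory Num.Theory.
Import numFieldNormedType.Exports.

Local Open Scope classical_set_scope.
Local Open Scope ring_scope.

(** * Averages over signs and Khintchine's inequalities *)

Definition average (R : realType) (I : finType) (F : I -> R) : R :=
  #|I|%:R^-1 * \sum_i F i.

Section average.
Context {R : realType}.

Lemma ler_average (I : finType) (F G : I -> R) :
  (forall i, F i <= G i) -> average F <= average G.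
Proof. by move=> FG; rewrite ler_wpM2l ?invr_ge0// ler_sum. Qed.

Lemma average_ge0 (I : finType) (F : I -> R) :
  (forall i, 0 <= F i) -> 0 <= average F.
Proof. by move=> F0; rewrite mulr_ge0 ?invr_ge0// sumr_ge0. Qed.

Lemma averageD (I : finType) (F G : I -> R) :
  average (fun i => F i + G i) = average F + average G.
Proof. by rewrite /average big_split mulrDr. Qed.

Lemma averageZ (I : finType) c (F : I -> R) :
  average (fun i => c * F i) = c * average F.
Proof. by rewrite /average -mulr_sumr mulrCA. Qed.

(** Averaging over a product of copies of [J] turns products into products: the
    coordinates are independent. *)
Lemma average_prod (I J : finType) (F : I -> J -> R) :
  average (fun e : {ffun I -> J} => \prod_i F i (e i)) =
  \prod_i average (F i).
Proof.
rewrite /average big_split /= -bigA_distr_bigA /= prodr_const card_ffun natrX.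
by rewrite exprVn.
Qed.

End average.

Definition rademacher_sum (R : realType) (N : nat) (a : 'I_N -> R)
    (e : {ffun 'I_N -> bool}) : R := \sum_(k < N) (-1) ^+ (e k) * a k.

Section khintchine.
Context {R : realType}.
Implicit Types (x t r : R) (N : nat).

(** The sub-Gaussian bound, with a constant chosen for a short proof: for
    |x|^2 <= 1/2, exp (+- x) <= 1 / (1 -+ x), and otherwise |x| <= 2 x^2. *)
Lemma cosh_le_expR2sqr x : expR x + expR (- x) <= 2 * expR (2 * x ^+ 2).
Proof.
have [x2|x2] := lerP (x ^+ 2) 2^-1.
  have x1 : `|x| < 1.
    rewrite -(@ltr_pXn2r _ 2) ?nnegrE// expr1n real_normK ?num_real//.
    by rewrite (le_lt_trans x2)//; lra.
  have inv_le (y : R) : `|y| < 1 -> expR y <= (1 - y)^-1.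
    move=> y1; have y1' : 0 < 1 - y by rewrite subr_gt0 (le_lt_trans (ler_norm _)).
    rewrite -[y in expR y]opprK expRN lef_pV2 ?posrE ?expR_gt0//.
    exact: expR_ge1Dx.
  have /andP[x1l x1r] : -1 < x < 1 by rewrite -ltr_norml.
  have h1 := inv_le _ x1; have h2 := inv_le (- x); rewrite normrN in h2.
  have {}h2 := h2 x1; rewrite opprK in h2.
  have h3 : (1 - x)^-1 + (1 + x)^-1 <= 2 * (1 + 2 * x ^+ 2).
    have -> : (1 - x)^-1 + (1 + x)^-1 = 2 / (1 - x ^+ 2) by field; nra.
    rewrite ler_pdivrMr; last by lra.
    set y := x ^+ 2 in x2 *; have : 0 <= y by rewrite sqr_ge0.
    by nra.
  have := expR_ge1Dx (2 * x ^+ 2); lra.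
have h (y : R) : `|y| = `|x| -> expR y <= expR (2 * x ^+ 2).
  move=> yx; rewrite ler_expR (le_trans (ler_norm _))// yx.
  rewrite -(real_normK (num_real x)) in x2 *.
  set z := `|x| in x2 *; have z0 : 0 <= z by rewrite normr_ge0.
  by nra.
by rewrite mulr_natl mulr2n lerD// h ?normrN.
Qed.

Lemma average_expR_rademacher N (a : 'I_N -> R) t :
  average (fun e => expR (t * rademacher_sum a e)) <=
  expR (2 * t ^+ 2 * \sum_k a k ^+ 2).
Proof.
have -> : (fun e => expR (t * rademacher_sum a e)) = (fun e : {ffun 'I_N -> bool} =>
    \prod_k (fun k b => expR (t * ((-1) ^+ b * a k))) k (e k)).
  by apply/funext => e; rewrite /rademacher_sum mulr_sumr expR_sum.
rewrite (average_prod (fun k (b : bool) => expR (t * ((-1) ^+ b * a k)))).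
rewrite mulr_sumr expR_sum; apply: ler_prod => k _.
rewrite average_ge0 => [/=|b]; last exact: expR_ge0.
rewrite /average card_bool big_bool /= expr1 expr0 mul1r mulN1r mulrN.
rewrite ler_pdivrMl// addrC -mulrA -exprMn; exact: cosh_le_expR2sqr.
Qed.

Lemma exprn_le_expR n x : 0 <= x -> x ^+ n <= n%:R ^+ n * expR x.
Proof.
case: n => [|n] x0; first by rewrite !expr0 mul1r -expR0 ler_expR.
have -> : expR x = expR (x / n.+1%:R) ^+ n.+1.
  by rewrite -expRM_natr -mulrA mulVf// mulr1.
rewrite -exprMn ler_pXn2r ?nnegrE ?mulr_ge0 ?expR_ge0//.
rewrite -ler_pdivrMl// mulrC; apply: le_trans _ (expR_ge1Dx _).
by rewrite lerDr.
Qed.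

Definition powR_expR_const (r : R) : R :=
  let n := (Num.truncn r).+1 in 1 + n%:R ^+ n.

(** Moments are dominated by the exponential moments that independence computes. *)
Lemma powR_le_expR r x : 0 < r ->
  `|x| `^ r <= powR_expR_const r * (expR x + expR (- x)).
Proof.
move=> r0; rewrite /powR_expR_const; set n := (Num.truncn r).+1.
have rn : r <= n%:R by apply/ltW/truncnS_gt.
have h (y : R) : 0 <= y -> y `^ r <= (1 + n%:R ^+ n) * expR y.
  move=> y0; have [y1|y1] := lerP y 1.
    apply: (@le_trans _ _ 1).
      rewrite [leRHS](_ : _ = 1 `^ r); last by rewrite powR1.
      by rewrite ge0_ler_powR ?nnegrE// ltW.
    rewrite -[leLHS]mulr1 ler_pM//; last by rewrite -expR0 ler_expR.
    by rewrite lerDl exprn_ge0.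
  apply: le_trans (_ : y ^+ n <= _).
    by rewrite -powR_mulrn// ler_powR// ltW.
  apply: (le_trans (exprn_le_expR n y0)); rewrite ler_wpM2r ?expR_ge0//.
  by rewrite lerDr.
have c0 : 0 <= 1 + n%:R ^+ n :> R by rewrite addr_ge0// exprn_ge0.
apply: (le_trans (h _ (normr_ge0 _))); rewrite ler_wpM2l//.
have [x0|x0] := lerP 0 x; first by rewrite ger0_norm// lerDl expR_ge0.
by rewrite ltr0_norm// lerDr expR_ge0.
Qed.

Definition khintchine_const (r : R) : R := powR_expR_const r * (2 * expR 2).

Lemma khintchine_const_ge1 r : 1 <= khintchine_const r.
Proof.
rewrite /khintchine_const /powR_expR_const -[leLHS]mulr1; apply: ler_pM => //.
  by rewrite lerDl exprn_ge0.
by rewrite -[leLHS]mulr1 ler_pM// ?ler1n// -expR0 ler_expR.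
Qed.

Lemma rademacher_sum_eq0 N (a : 'I_N -> R) e : \sum_k a k ^+ 2 = 0 ->
  rademacher_sum a e = 0.
Proof.
move=> /psumr_eq0P h; rewrite /rademacher_sum big1// => k _.
have /eqP : a k ^+ 2 = 0 by apply: h => // i _; exact: sqr_ge0.
by rewrite sqrf_eq0 => /eqP ->; rewrite mulr0.
Qed.

(** With t^2 the sum of the squares, S / t has exponential moments bounded by an
    absolute constant, and these dominate |S / t|^r. *)
Lemma khintchine_upper N (a : 'I_N -> R) r : 0 < r ->
  average (fun e => `|rademacher_sum a e| `^ r) <=
  khintchine_const r * (\sum_k a k ^+ 2) `^ (r / 2).
Proof.
move=> r0; set s := \sum_k _.
have s0 : 0 <= s by apply: sumr_ge0 => k _; exact: sqr_ge0.
have [s00|s00] := eqVneq s 0.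
  rewrite [leLHS](_ : _ = 0).
    by rewrite mulr_ge0 ?powR_ge0// (le_trans _ (khintchine_const_ge1 r)).
  rewrite /average big1 ?mulr0// => e _.
  by rewrite rademacher_sum_eq0// normr0 powR0// gt_eqF.
have {}s0 : 0 < s by rewrite lt_def s00.
set t := Num.sqrt s; have t0 : 0 < t by rewrite sqrtr_gt0.
have ts : t ^+ 2 = s by rewrite sqr_sqrtr// ltW.
have tr : s `^ (r / 2) = t `^ r.
  by rewrite mulrC powRrM powR12_sqrt// ltW.
apply: (@le_trans _ _ (average (fun e => t `^ r * powR_expR_const r *
   (expR (t^-1 * rademacher_sum a e) + expR (- t^-1 * rademacher_sum a e))))).
  apply: ler_average => e; rewrite -mulrA mulNr.
  have {1}-> : rademacher_sum a e = t * (t^-1 * rademacher_sum a e).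
    by rewrite mulrA divff ?mul1r// gt_eqF.
  rewrite normrM (gtr0_norm t0) powRM ?(ltW t0)//.
  by rewrite ler_wpM2l ?powR_ge0// powR_le_expR.
rewrite averageZ averageD tr [leRHS]mulrC -mulrA ler_wpM2l ?powR_ge0//.
have c0 : 0 <= powR_expR_const r.
  by rewrite /powR_expR_const addr_ge0// exprn_ge0.
rewrite /khintchine_const ler_wpM2l//.
have h (u : R) : u ^+ 2 = s^-1 ->
    average (fun e => expR (u * rademacher_sum a e)) <= expR 2.
  move=> us; apply: (le_trans (average_expR_rademacher _ _)).
  by rewrite us -mulrA mulVf ?mulr1// gt_eqF.
by rewrite mulr_natl mulr2n; apply: lerD; apply: h; rewrite ?sqrrN exprVn ts.
Qed.

Lemma average_sign2 N (k l : 'I_N) :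
  average (fun e : {ffun 'I_N -> bool} => (-1) ^+ (e k) * (-1) ^+ (e l)) =
  (k == l)%:R :> R.
Proof.
have [<-|kl] := eqVneq k l.
  rewrite /average (eq_bigr (fun=> 1)) => [|e _]; last first.
    by rewrite -expr2 sqrr_sign.
  rewrite sumr_const mulVf// pnatr_eq0 -lt0n.
  by apply/card_gt0P; exists [ffun=> true].
pose flip (e : {ffun 'I_N -> bool}) := [ffun i => e i (+) (i == k)].
have flipK : involutive flip.
  by move=> e; apply/ffunP => i; rewrite !ffunE -addbA addbb addbF.
rewrite /average; set S := \sum_e _.
suff /eqP : S = - S.
  by rewrite -addr_eq0 -mulr2n mulrn_eq0 => /eqP ->; rewrite mulr0.
rewrite {1}/S (reindex_inj (inv_inj flipK)) /= -sumrN.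
apply: eq_bigr => e _; rewrite !ffunE eqxx (negbTE (_ : l != k)) 1?eq_sym//.
by rewrite addbF addbT signrN mulNr.
Qed.

Lemma average_rademacher2 N (a : 'I_N -> R) :
  average (fun e => rademacher_sum a e ^+ 2) = \sum_k a k ^+ 2.
Proof.
transitivity (\sum_k \sum_l a k * a l * average (fun e : {ffun 'I_N -> bool} =>
    (-1) ^+ (e k) * (-1) ^+ (e l) : R)).
  rewrite /average; under [RHS]eq_bigr => k _.
    under eq_bigr => l _ do rewrite mulrCA mulr_sumr.
    over.
  under [RHS]eq_bigr => k _ do rewrite -mulr_sumr exchange_big /=.
  rewrite -mulr_sumr exchange_big /=; congr (_ * _); apply: eq_bigr => e _.
  rewrite expr2 /rademacher_sum mulr_suml; apply: eq_bigr => k _.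
  by rewrite mulr_sumr; apply: eq_bigr => l _; rewrite mulrACA mulrC.
apply: eq_bigr => k _; rewrite (bigD1 k)//= average_sign2 eqxx mulr1 -expr2.
rewrite big1 ?addr0// => l lk; rewrite average_sign2 eq_sym (negbTE lk).
by rewrite mulr0.
Qed.

(** Splitting at [lam]: below it the first term dominates [y], above it the
    second. Integrated, it bounds a low moment from below by means of the first
    two. *)
Lemma le_powR_interpolation (alpha lam y : R) : 0 <= alpha <= 1 -> 0 < lam -> 0 <= y ->
  y <= lam `^ (1 - alpha) * y `^ alpha + y ^+ 2 / lam.
Proof.
move=> /andP[a0 a1] l0; rewrite le_eqVlt => /predU1P[<-|y0].
  by rewrite addr_ge0 ?mulr_ge0 ?powR_ge0// invr_ge0 ltW.
have [yl|yl] := lerP y lam.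
  rewrite -[leLHS]addr0 lerD ?divr_ge0 ?sqr_ge0 ?(ltW l0)//.
  rewrite -{1}(powRr1 (ltW y0)) -[in leLHS](subrK alpha 1) powRD; last first.
    by apply/implyP => _; rewrite gt_eqF.
  by rewrite ler_wpM2r ?powR_ge0// ge0_ler_powR ?nnegrE ?subr_ge0// ltW.
rewrite -[leLHS]add0r lerD ?mulr_ge0 ?powR_ge0//.
by rewrite ler_pdivlMr// expr2 ler_wpM2l// ltW.
Qed.

(** The pairs (a_k, b_k) stand for complex numbers a_k + i b_k, so that one
    statement serves real and complex scalars; s^(r/2) is then the square function
    to the power r. *)
Lemma khintchine2_upper N (a b : 'I_N -> R) r : 0 < r ->
  average (fun e => (rademacher_sum a e ^+ 2 + rademacher_sum b e ^+ 2) `^ (r / 2))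
  <= 2 * 2 `^ (r / 2) * khintchine_const r *
     (\sum_k (a k ^+ 2 + b k ^+ 2)) `^ (r / 2).
Proof.
move=> r0; have r20 : 0 <= r / 2 by rewrite divr_ge0// ltW.
have K0 : 0 <= khintchine_const r by rewrite (le_trans _ (khintchine_const_ge1 r)).
have pt (x y : R) : (x ^+ 2 + y ^+ 2) `^ (r / 2) <=
    2 `^ (r / 2) * (`|x| `^ r + `|y| `^ r).
  wlog xy : x y / `|x| <= `|y|.
    move=> H; have [/H//|/ltW /H] := lerP `|x| `|y|.
    by rewrite addrC [in leRHS]addrC.
  have xy2 : x ^+ 2 <= y ^+ 2.
    by rewrite -(real_normK (num_real x)) -(real_normK (num_real y))
               ler_pXn2r ?nnegrE.
  apply: (@le_trans _ _ ((2 * y ^+ 2) `^ (r / 2))).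
    apply: ge0_ler_powR => //; rewrite ?nnegrE.
    - by rewrite addr_ge0 ?sqr_ge0.
    - by rewrite pmulr_rge0 ?sqr_ge0.
    - by rewrite mulr_natl mulr2n lerD2r.
  rewrite powRM ?sqr_ge0// ler_wpM2l ?powR_ge0//.
  rewrite -(real_normK (num_real y)) -powR_mulrn// -powRrM.
  by rewrite mulrC divfK// lerDr powR_ge0.
apply: (@le_trans _ _ (average (fun e => 2 `^ (r / 2) *
    (`|rademacher_sum a e| `^ r + `|rademacher_sum b e| `^ r)))).
  by apply: ler_average => e; exact: pt.
set S := (\sum_k (a k ^+ 2 + b k ^+ 2)) `^ _.
rewrite averageZ averageD.
have -> : 2 * 2 `^ (r / 2) * khintchine_const r * S =
  2 `^ (r / 2) * (khintchine_const r * S + khintchine_const r * S) by ring.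
rewrite ler_wpM2l ?powR_ge0//.
have h (c : 'I_N -> R) : (forall k, c k ^+ 2 <= a k ^+ 2 + b k ^+ 2) ->
    average (fun e => `|rademacher_sum c e| `^ r) <=
    khintchine_const r * (\sum_k (a k ^+ 2 + b k ^+ 2)) `^ (r / 2).
  move=> cab; apply: (le_trans (khintchine_upper _ r0)).
  rewrite ler_wpM2l// ge0_ler_powR ?nnegrE ?sumr_ge0//.
  - by move=> k _; exact: sqr_ge0.
  - by move=> k _; rewrite addr_ge0 ?sqr_ge0.
  - by apply: ler_sum => k _; exact: cab.
by apply: lerD; apply: h => k; rewrite ?lerDl ?lerDr sqr_ge0.
Qed.

Definition khintchine_lower_const : R := 4 * (8 * khintchine_const 4).

Lemma khintchine_lower_const_ge0 : 0 <= khintchine_lower_const.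
Proof.
rewrite pmulr_rge0// pmulr_rge0//; exact: le_trans ler01 (khintchine_const_ge1 4).
Qed.

(** For Y = |S|^2 the mean is s and the second moment is at most L s^2, by the
    upper inequality with exponent 4. Interpolating Y between Y^alpha and Y^2 at
    the level 2 L s, the second moment absorbs only half of the mean, so E Y^alpha
    is at least a multiple of s^alpha. The constant does not depend on [alpha]. *)
Lemma khintchine2_lower N (a b : 'I_N -> R) (alpha : R) : 0 < alpha <= 1 ->
  (\sum_k (a k ^+ 2 + b k ^+ 2)) `^ alpha <=
  khintchine_lower_const * average (fun e =>
    (rademacher_sum a e ^+ 2 + rademacher_sum b e ^+ 2) `^ alpha).
Proof.
move=> /andP[a0 a1]; set s := \sum_k _.
pose Y e := rademacher_sum a e ^+ 2 + rademacher_sum b e ^+ 2.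
have Y0 e : 0 <= Y e by rewrite addr_ge0 ?sqr_ge0.
have Es : average Y = s.
  by rewrite averageD !average_rademacher2 /s big_split.
have s0 : 0 <= s by rewrite -Es average_ge0.
pose L : R := 8 * khintchine_const 4.
have L1 : 1 <= L.
  have K1 := khintchine_const_ge1 (4 : R); rewrite /L.
  rewrite (le_trans K1)// ler_peMl// ?ler1n//.
  exact: le_trans ler01 K1.
have L0 : 0 < L by exact: lt_le_trans ltr01 L1.
have EY2 : average (fun e => Y e ^+ 2) <= L * s ^+ 2.
  have r4 : (4 / 2 : R) = 2%:R by lra.
  have := @khintchine2_upper N a b 4 ltac:(by []).
  rewrite -/s r4 !powR_mulrn//.
  have -> : average (fun e => (rademacher_sum a e ^+ 2 +
      rademacher_sum b e ^+ 2) `^ 2) = average (fun e => Y e ^+ 2).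
    by congr average; apply/funext => e; rewrite powR_mulrn ?Y0.
  move/le_trans; apply; rewrite ler_wpM2r ?sqr_ge0// /L.
  by have := khintchine_const_ge1 (4 : R); lra.
rewrite -/(average (fun e => Y e `^ alpha)) /khintchine_lower_const -/L.
clearbody L.
have A0 : 0 <= average (fun e => Y e `^ alpha).
  by apply: average_ge0 => e; exact: powR_ge0.
move: s0; rewrite le_eqVlt => /predU1P[s0|s0].
  by rewrite -s0 powR0 ?gt_eqF// mulr_ge0// mulr_ge0// ltW.
have h : s <= (2 * L * s) `^ (1 - alpha) * average (fun e => Y e `^ alpha) +
    (2 * L * s)^-1 * average (fun e => Y e ^+ 2).
  rewrite -{1}Es -!averageZ -averageD; apply: ler_average => e.
  rewrite [_^-1 * _]mulrC; apply: le_powR_interpolation => //.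
  - by rewrite (ltW a0).
  - by rewrite !mulr_gt0.
have h2 : (2 * L * s)^-1 * average (fun e => Y e ^+ 2) <= s / 2.
  rewrite ler_pdivrMl ?mulr_gt0//.
  by apply: (le_trans EY2); rewrite expr2; lra.
have h3 : s / 2 <= (2 * L * s) `^ (1 - alpha) * average (fun e => Y e `^ alpha).
  lra.
have h4 : (2 * L * s) `^ (1 - alpha) <= 2 * L * s `^ (1 - alpha).
  rewrite powRM ?mulr_ge0 ?(ltW L0) ?(ltW s0)//; rewrite ler_wpM2r ?powR_ge0//.
  rewrite -[leRHS]powRr1; [|lra]; rewrite ler_powR; lra.
have h5 : s = s `^ alpha * s `^ (1 - alpha).
  rewrite -powRD; last by apply/implyP => _; rewrite gt_eqF.
  by rewrite addrC subrK powRr1// ltW.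
have h6 : 0 < s `^ (1 - alpha) by rewrite powR_gt0.
rewrite -(ler_pM2r h6) -h5.
have := ler_wpM2r A0 h4; set A := average _ in A0 h3 *; set u := s `^ _ in h6 *.
by move=> h7; lra.
Qed.

End khintchine.

(** * Real and complex scalars, simple functions, linear operators *)

Section scalars.
Context {R : realType} {k : scalars}.
Local Notation K := (scalar_field R k).

(** With [im_scalar], coordinates in which both scalar fields become subspaces of
    the plane. *)
Definition re_scalar : K -> R :=
  match k return scalar_field R k -> R with
  | RealScalars => fun x : R => x
  | ComplexScalars => fun z : R[i] => complex.Re z
  end.

Definition im_scalar : K -> R :=
  match k return scalar_field R k -> R with
  | RealScalars => fun=> 0
  | ComplexScalars => fun z : R[i] => complex.Im z
  end.

Definition scalar_of_real : R -> K :=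
  match k return R -> scalar_field R k with
  | RealScalars => fun x : R => x
  | ComplexScalars => fun x : R => (x%:C)%C
  end.

Lemma re_scalarD (z w : K) : re_scalar (z + w) = re_scalar z + re_scalar w.
Proof. by move: z w; rewrite /re_scalar; case: k => //= -[a b] [a' b']. Qed.

Lemma im_scalarD (z w : K) : im_scalar (z + w) = im_scalar z + im_scalar w.
Proof.
move: z w; rewrite /im_scalar; case: k => /=; first by rewrite addr0.
by move=> [a b] [a' b'].
Qed.

Lemma re_scalarM c (z : K) : re_scalar (scalar_of_real c * z) = c * re_scalar z.
Proof.
move: z; rewrite /re_scalar /scalar_of_real; case: k => //= -[a b] /=.
by rewrite mul0r subr0.
Qed.

Lemma im_scalarM c (z : K) : im_scalar (scalar_of_real c * z) = c * im_scalar z.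
Proof.
move: z; rewrite /im_scalar /scalar_of_real; case: k => /=; first by rewrite mulr0.
by move=> [a b] /=; rewrite mul0r addr0.
Qed.

Lemma re_scalar0 : re_scalar 0 = 0.
Proof. by rewrite /re_scalar; case: k. Qed.

Lemma im_scalar0 : im_scalar 0 = 0.
Proof. by rewrite /im_scalar; case: k. Qed.

Lemma modulusE (z : K) : modulus z = Num.sqrt (re_scalar z ^+ 2 + im_scalar z ^+ 2).
Proof.
move: z; rewrite /modulus /re_scalar /im_scalar; case: k => /= [x|[a b]//].
by rewrite expr0n /= addr0 sqrtr_sqr.
Qed.

Lemma modulus_ge0 (z : K) : 0 <= modulus z.
Proof. by rewrite modulusE sqrtr_ge0. Qed.

Lemma modulus_sqr (z : K) : modulus z ^+ 2 = re_scalar z ^+ 2 + im_scalar z ^+ 2.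
Proof. by rewrite modulusE sqr_sqrtr// addr_ge0 ?sqr_ge0. Qed.

Lemma modulus0 : modulus (0 : K) = 0.
Proof. by rewrite modulusE re_scalar0 im_scalar0 expr0n /= addr0 sqrtr0. Qed.

Lemma modulusM c (z : K) : modulus (scalar_of_real c * z) = `|c| * modulus z.
Proof.
rewrite !modulusE re_scalarM im_scalarM !exprMn -mulrDr sqrtrM ?sqr_ge0//.
by rewrite sqrtr_sqr.
Qed.

Lemma modulus_powR (z : K) r : modulus z `^ r = (modulus z ^+ 2) `^ (r / 2).
Proof.
by rewrite -powR_mulrn ?modulus_ge0// -powRrM mulrC divfK.
Qed.

Lemma re_scalar_sum N (c : 'I_N -> R) (z : 'I_N -> K) :
  re_scalar (\sum_i scalar_of_real (c i) * z i) = \sum_i c i * re_scalar (z i).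
Proof.
rewrite (big_morph _ re_scalarD re_scalar0).
by apply: eq_bigr => i _; rewrite re_scalarM.
Qed.

Lemma im_scalar_sum N (c : 'I_N -> R) (z : 'I_N -> K) :
  im_scalar (\sum_i scalar_of_real (c i) * z i) = \sum_i c i * im_scalar (z i).
Proof.
rewrite (big_morph _ im_scalarD im_scalar0).
by apply: eq_bigr => i _; rewrite im_scalarM.
Qed.

Lemma modulusD_powR (z w : K) r : 0 <= r ->
  modulus (z + w) `^ r <= 4 `^ (r / 2) * (modulus z `^ r + modulus w `^ r).
Proof.
move=> r0; wlog zw : z w / modulus z ^+ 2 <= modulus w ^+ 2.
  move=> H; have [/H//|/ltW /H] := lerP (modulus z ^+ 2) (modulus w ^+ 2).
  by rewrite addrC [in leRHS]addrC.
apply: (@le_trans _ _ (4 `^ (r / 2) * modulus w `^ r)); last first.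
  by rewrite ler_wpM2l ?powR_ge0// lerDr powR_ge0.
rewrite !modulus_powR -powRM ?sqr_ge0//.
apply: ge0_ler_powR; rewrite ?nnegrE ?divr_ge0//; first exact: sqr_ge0.
  by rewrite pmulr_rge0 ?sqr_ge0.
move: zw; rewrite !modulus_sqr re_scalarD im_scalarD => zw.
set a := re_scalar z in zw *; set b := im_scalar z in zw *.
set a' := re_scalar w in zw *; set b' := im_scalar w in zw *.
by have := sqr_ge0 (a - a'); have := sqr_ge0 (b - b'); rewrite !expr2 in zw *; nra.
Qed.

End scalars.

Section measurable_scalars.
Context {R : realType} {k : scalars} d {X : measurableType d}.
Local Notation K := (scalar_field R k).

Lemma measurable_scalar_funP (f : X -> K) : measurable_scalar_fun f <->
  measurable_fun setT (fun x => re_scalar (f x)) /\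
  measurable_fun setT (fun x => im_scalar (f x)).
Proof.
move: f; rewrite /measurable_scalar_fun /re_scalar /im_scalar.
by case: k => f //=; split=> [|[]].
Qed.

Lemma measurable_modulus (f : X -> K) : measurable_scalar_fun f ->
  measurable_fun setT (fun x => modulus (f x)).
Proof.
move=> /measurable_scalar_funP[mr mi].
rewrite (_ : (fun _ => _) = fun x =>
    (re_scalar (f x) ^+ 2 + im_scalar (f x) ^+ 2) `^ 2^-1); last first.
  by apply/funext => x; rewrite modulusE powR12_sqrt// addr_ge0 ?sqr_ge0.
apply: (@measurableT_comp _ _ _ _ _ _ (@powR R ^~ 2^-1)) => //.
by apply: measurable_funD; exact: measurable_funX.
Qed.

Lemma measurable_scalar_fun_lin c (f g : X -> K) :
  measurable_scalar_fun f -> measurable_scalar_fun g ->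
  measurable_scalar_fun (fun x => scalar_of_real c * f x + g x).
Proof.
move=> /measurable_scalar_funP[rf jf] /measurable_scalar_funP[rg jg].
apply/measurable_scalar_funP; split.
  under eq_fun do rewrite re_scalarD re_scalarM.
  by apply: measurable_funD => //; exact: measurable_funM.
under eq_fun do rewrite im_scalarD im_scalarM.
by apply: measurable_funD => //; exact: measurable_funM.
Qed.

End measurable_scalars.

Section simple_functions_space.
Context {R : realType} {k : scalars} d {Y : measurableType d}.
Variables (nu : {measure set Y -> \bar R}) (r : R).
Hypothesis r_gt0 : 0 < r.
Local Notation K := (scalar_field R k).
Local Notation S := (simple_functions nu r%:E).
Implicit Types f g : Y -> K.

Lemma lpnorm_powR f :
  (lpnorm nu r%:E f `^ r = \int[nu]_y (modulus (f y) `^ r)%:E)%E.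
Proof.
rewrite /lpnorm poweR_Lnorm ?gt_eqF//; apply: eq_integral => y _.
by rewrite -poweR_EFin gee0_abs// lee_fin modulus_ge0.
Qed.

Lemma lpnorm_lty f :
  (lpnorm nu r%:E f < +oo <-> \int[nu]_y (modulus (f y) `^ r)%:E < +oo)%E.
Proof.
rewrite -lpnorm_powR; split; first exact: poweR_lty.
by apply: lty_poweRy; rewrite gt_eqF.
Qed.

Lemma simple_functions0 : S (fun=> 0 : K).
Proof.
split.
- apply/measurable_scalar_funP; split.
    exact: measurable_cst.
  exact: measurable_cst.
- apply: (@sub_finite_set _ _ [set 0]); last exact: finite_set1.
  by move=> _ [y _ <-].
- apply/lpnorm_lty; rewrite integral0_eq ?ltry// => y _.
  by rewrite modulus0 powR0 ?gt_eqF.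
Qed.

Lemma measurable_modulus_powR f : measurable_scalar_fun f ->
  measurable_fun setT (fun y => (modulus (f y) `^ r)%:E).
Proof.
move=> mf; apply/measurable_EFinP.
apply: (@measurableT_comp _ _ _ _ _ _ (@powR R ^~ r)) => //.
exact: measurable_modulus.
Qed.

Lemma simple_functions_lin c f g : S f -> S g ->
  S (fun y => scalar_of_real c * f y + g y).
Proof.
move=> [mf ff /lpnorm_lty nf] [mg fg /lpnorm_lty ng]; split.
- exact: measurable_scalar_fun_lin.
- apply: sub_finite_set (finite_image2 (fun z w => scalar_of_real c * z + w) ff fg).
  by move=> _ [y _ <-]; exists (f y); [exists y|exists (g y); [exists y|]].
apply/lpnorm_lty.
set C := 4 `^ (r / 2).
have le_pt y : modulus (scalar_of_real c * f y + g y) `^ r <=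
    C * `|c| `^ r * modulus (f y) `^ r + C * modulus (g y) `^ r.
  apply: (le_trans (modulusD_powR _ _ (ltW r_gt0))).
  by rewrite modulusM powRM ?modulus_ge0// mulrDr mulrA.
have C0 : 0 <= C by exact: powR_ge0.
have Cc0 : 0 <= C * `|c| `^ r by rewrite mulr_ge0 ?powR_ge0.
apply: (@le_lt_trans _ _ (\int[nu]_y ((C * `|c| `^ r)%:E * (modulus (f y) `^ r)%:E +
    C%:E * (modulus (g y) `^ r)%:E))%E).
  apply: ge0_le_integral => //.
  - by move=> y _; rewrite lee_fin powR_ge0.
  - by apply: measurable_modulus_powR; exact: measurable_scalar_fun_lin.
  - by apply: emeasurable_funD; apply: measurable_funeM; exact: measurable_modulus_powR.
  - by move=> y _; rewrite -!EFinM -EFinD lee_fin.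
rewrite ge0_integralD//; last 4 first.
- by move=> y _; rewrite mule_ge0// lee_fin powR_ge0.
- by apply: measurable_funeM; exact: measurable_modulus_powR.
- by move=> y _; rewrite mule_ge0// lee_fin powR_ge0.
- by apply: measurable_funeM; exact: measurable_modulus_powR.
rewrite !ge0_integralZl_EFin//; try exact: measurable_modulus_powR.
- by rewrite lte_add_pinfty// lte_mul_pinfty// lee_fin.
- by move=> y _; rewrite lee_fin powR_ge0.
- by move=> y _; rewrite lee_fin powR_ge0.
Qed.

Lemma simple_functions_sum N (c : 'I_N -> R) (f : 'I_N -> Y -> K) :
  (forall i, S (f i)) -> S (fun y => \sum_i scalar_of_real (c i) * f i y).
Proof.
elim: N c f => [|N IH] c f Sf.
  by under [X in S X]eq_fun do rewrite big_ord0; exact: simple_functions0.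
under [X in S X]eq_fun do rewrite big_ord_recl.
by apply: simple_functions_lin => //; exact: IH.
Qed.

(** [linear_operator] only gives binary combinations almost everywhere; a finite
    sum uses finitely many of them, hence still holds almost everywhere. *)
Lemma linear_operator_sum dX (X : measurableType dX) (mu : {measure set X -> \bar R})
    (T : (Y -> K) -> X -> K) : linear_operator mu S T ->
  forall N (c : 'I_N -> R) (f : 'I_N -> Y -> K), (forall i, S (f i)) ->
  {ae mu, forall x, T (fun y => \sum_i scalar_of_real (c i) * f i y) x =
    \sum_i scalar_of_real (c i) * T (f i) x}.
Proof.
move=> [_ linT]; elim=> [|N IH] c f Sf.
  have -> : (fun y : Y => \sum_(i < 0) scalar_of_real (c i) * f i y) = (fun=> 0).
    by apply/funext => y; rewrite big_ord0.
  have := linT 1 _ _ simple_functions0 simple_functions0.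
  apply: filterS => x; rewrite big_ord0.
  under [X in T X]eq_fun do rewrite mul1r addr0.
  by rewrite mul1r -[LHS]addr0 => /addrI.
pose f' i := f (lift ord0 i); pose c' i := c (lift ord0 i).
have Sf' i : S (f' i) by exact: Sf.
have -> : (fun y => \sum_i scalar_of_real (c i) * f i y) =
    (fun y => scalar_of_real (c ord0) * f ord0 y +
       \sum_i scalar_of_real (c' i) * f' i y).
  by apply/funext => y; rewrite big_ord_recl.
have := linT (scalar_of_real (c ord0)) _ _ (Sf ord0) (simple_functions_sum c' Sf').
by apply: filterS2 (IH c' f' Sf') => x TN ->; rewrite TN big_ord_recl.
Qed.

End simple_functions_space.

(** * Weighted geometric means *)

Section geometric_mean.
Context {R : realType} {n : nat}.
Implicit Types (alpha u v : 'I_n -> R).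

Definition geomean alpha u : R := \prod_j u j `^ alpha j.

Lemma geomean_ge0 alpha u : 0 <= geomean alpha u.
Proof. by apply: prodr_ge0 => j _; exact: powR_ge0. Qed.

Lemma geomean_gt0 alpha u : (forall j, 0 < u j) -> 0 < geomean alpha u.
Proof. by move=> u0; apply: prodr_gt0 => j _; exact: powR_gt0. Qed.

Lemma geomeanM alpha u v : (forall j, 0 <= u j) -> (forall j, 0 <= v j) ->
  geomean alpha (fun j => u j * v j) = geomean alpha u * geomean alpha v.
Proof.
by move=> u0 v0; rewrite /geomean -big_split; apply: eq_bigr => j _; rewrite powRM.
Qed.

Lemma geomean_cst alpha c : \sum_j alpha j = 1 -> (forall j, 0 < alpha j) ->
  0 <= c -> geomean alpha (fun=> c) = c.
Proof.
move=> a1 a0; rewrite le_eqVlt => /predU1P[<-|c0].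
  have [j _|n0] := pickP 'I_n; last first.
    by move: a1; rewrite big_pred0// => /eqP; rewrite eq_sym oner_eq0.
  by rewrite /geomean (bigD1 j)//= powR0 ?mul0r ?gt_eqF.
rewrite /geomean /powR gt_eqF// -expR_sum -mulr_suml a1 mul1r lnK//.
Qed.

Lemma geomeanZ alpha c u : \sum_j alpha j = 1 -> (forall j, 0 < alpha j) ->
  0 <= c -> (forall j, 0 <= u j) ->
  geomean alpha (fun j => c * u j) = c * geomean alpha u.
Proof.
by move=> a1 a0 c0 u0; rewrite (@geomeanM _ (fun=> c))// geomean_cst.
Qed.

Lemma geomean_eq0 alpha u j : 0 < alpha j -> u j = 0 -> geomean alpha u = 0.
Proof.
by move=> a0 u0; rewrite /geomean (bigD1 j)//= u0 powR0 ?mul0r ?gt_eqF.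
Qed.

Lemma ler_geomean alpha u v : (forall j, 0 < alpha j) ->
  (forall j, 0 <= u j <= v j) -> geomean alpha u <= geomean alpha v.
Proof.
move=> a0 uv; apply: ler_prod => j _; rewrite powR_ge0 /=.
have /andP[u0 uvj] := uv j.
by rewrite ge0_ler_powR ?nnegrE ?(ltW (a0 j))// (le_trans u0).
Qed.

(** A linear lower bound for the concave function ln gives ln (1 + u) >= u / 2 for
    0 <= u <= 1; then exponentiate. *)
Lemma geomean_1D_ge alpha u : (forall j, 0 < alpha j) ->
  (forall j, 0 <= u j <= 1) ->
  1 + \sum_j alpha j * u j / 2 <= geomean alpha (fun j => 1 + u j).
Proof.
move=> a0 u01; apply: (@le_trans _ _ (expR (\sum_j alpha j * u j / 2))).
  exact: expR_ge1Dx.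
rewrite expR_sum; apply: ler_prod => j _; rewrite expR_ge0 /=.
have /andP[u0 u1] := u01 j.
have h : expR (u j / 2) <= 1 + u j.
  have := expR_ge1Dx (- (u j / 2)); rewrite expRN => h.
  rewrite -lef_pV2 ?posrE ?expR_gt0 ?ltr_pwDl//; apply: le_trans h.
  rewrite -[leLHS]mul1r ler_pdivrMr ?ltr_pwDl//; nra.
rewrite /powR gt_eqF ?ltr_pwDl// ler_expR -mulrA ler_wpM2l ?(ltW (a0 j))//.
by rewrite -ler_expR lnK// posrE ltr_pwDl.
Qed.

(** A quantitative form of the derivative of the geometric mean in the direction
    [v], valid as long as the perturbation is not larger than [u] itself. *)
Lemma geomean_perturb alpha u v t : (forall j, 0 < alpha j) ->
  (forall j, 0 < u j) -> (forall j, 0 <= t * v j <= u j) ->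
  geomean alpha u * (1 + \sum_j alpha j * (t * v j / u j) / 2) <=
  geomean alpha (fun j => u j + t * v j).
Proof.
move=> a0 u0 tv.
have -> : (fun j => u j + t * v j) = (fun j => u j * (1 + t * v j / u j)).
  by apply/funext => j; have := u0 j; move=> uj; field; rewrite gt_eqF.
have tvu j : 0 <= t * v j / u j <= 1.
  have /andP[tv0 tvu] := tv j; rewrite divr_ge0 ?(ltW (u0 j))//=.
  by rewrite ler_pdivrMr// mul1r.
rewrite geomeanM => [|j|j]; last 2 first.
- exact: ltW.
- by rewrite addr_ge0//; have /andP[] := tvu j.
rewrite ler_wpM2l ?geomean_ge0//; exact: geomean_1D_ge.
Qed.

(** Concavity of the geometric mean, in the form needed here: its superlevel sets
    are midpoint-convex. *)
Lemma geomean_midpoint alpha u v c : (forall j, 0 < alpha j) ->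
  (forall j, 0 <= u j) -> (forall j, 0 <= v j) -> 0 <= c ->
  c <= geomean alpha u -> c <= geomean alpha v ->
  c <= geomean alpha (fun j => (u j + v j) / 2).
Proof.
move=> a0 u0 v0 c0 cu cv.
rewrite -(@ler_pXn2r _ 2) ?nnegrE ?geomean_ge0// expr2.
apply: (le_trans (ler_pM c0 c0 cu cv)).
rewrite -geomeanM// expr2 -geomeanM => [|j|j]; last 2 first.
- by rewrite divr_ge0// addr_ge0.
- by rewrite divr_ge0// addr_ge0.
apply: ler_geomean => // j; rewrite mulr_ge0//=.
by have := sqr_ge0 (u j - v j); nra.
Qed.

End geometric_mean.

Lemma measurable_geomean d (X : measurableType d) (R : realType) n
    (alpha : 'I_n -> R) (u : 'I_n -> X -> R) :
  (forall j, measurable_fun setT (u j)) ->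
  measurable_fun setT (fun x => geomean alpha (u ^~ x)).
Proof.
move=> mu; apply: measurable_prod => j _.
exact: (@measurableT_comp _ _ _ _ _ _ (@powR R ^~ (alpha j))).
Qed.


(** * Random signed combinations *)

(** Young's inequality gives y_i s^(p-1) <= y_i^p / p + s^p / q, the tangent line of
    y^p at the mean s; average it. *)
Lemma jensen_powR (R : realType) N (w y : 'I_N -> R) (p : R) : 1 <= p ->
  (forall i, 0 <= w i) -> \sum_i w i = 1 -> (forall i, 0 <= y i) ->
  (\sum_i w i * y i) `^ p <= \sum_i w i * y i `^ p.
Proof.
rewrite le_eqVlt => /predU1P[<- w0 w1 y0|p1 w0 w1 y0].
  rewrite powRr1 ?sumr_ge0// => [|i _]; last by rewrite mulr_ge0.
  by rewrite le_eqVlt; apply/orP; left; apply/eqP; apply: eq_bigr => i _; rewrite powRr1.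
set s := \sum_i w i * y i.
have s0 : 0 <= s by apply: sumr_ge0 => i _; rewrite mulr_ge0.
have p0 : 0 < p by lra.
pose q := p / (p - 1); have q0 : 0 < q by rewrite divr_gt0//; lra.
have pq : p^-1 + q^-1 = 1.
  by rewrite /q; field; apply/andP; split; lra.
have sq : (s `^ (p - 1)) `^ q = s `^ p.
  by rewrite -powRrM /q; congr (_ `^ _); field; lra.
have young i : y i * s `^ (p - 1) <= y i `^ p / p + s `^ p / q.
  by rewrite -sq; apply: conjugate_powR => //; exact: powR_ge0.
have : \sum_i w i * (y i * s `^ (p - 1)) <= \sum_i w i * (y i `^ p / p + s `^ p / q).
  by apply: ler_sum => i _; rewrite ler_wpM2l.
rewrite (eq_bigr (fun i => w i * y i * s `^ (p - 1))) => [|i _]; last by rewrite mulrA.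
rewrite -mulr_suml -/s.
rewrite [X in _ <= X -> _](eq_bigr (fun i => w i * y i `^ p * p^-1 + w i * (s `^ p / q)));
  last by move=> i _; rewrite mulrDr mulrA.
rewrite big_split /= -!mulr_suml w1 mul1r.
have -> : s * s `^ (p - 1) = s `^ p.
  rewrite -{1}(powRr1 s0) -powRD; first by congr (_ `^ _); ring.
  by rewrite addrC subrK gt_eqF.
have -> : q^-1 = 1 - p^-1 by lra.
rewrite -lerBlDr => h; rewrite -(@ler_pM2r _ p^-1) ?invr_gt0//.
by apply: le_trans h; rewrite mulrBr mulr1; lra.
Qed.

Section randomized_combinations.
Context {R : realType} {k : scalars}.
Local Notation K := (scalar_field R k).

Definition signed_mix N (w : 'I_N -> R) (e : {ffun 'I_N -> bool}) (z : 'I_N -> K) : K :=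
  \sum_i scalar_of_real ((-1) ^+ (e i) * Num.sqrt (w i)) * z i.

Lemma signed_mix_sqr N (w : 'I_N -> R) e (z : 'I_N -> K) :
  modulus (signed_mix w e z) ^+ 2 =
  rademacher_sum (fun i => Num.sqrt (w i) * re_scalar (z i)) e ^+ 2 +
  rademacher_sum (fun i => Num.sqrt (w i) * im_scalar (z i)) e ^+ 2.
Proof.
rewrite modulus_sqr /signed_mix re_scalar_sum im_scalar_sum /rademacher_sum.
by congr (_ ^+ 2 + _ ^+ 2); apply: eq_bigr => i _; rewrite mulrA.
Qed.

Lemma signed_mix_variance N (w : 'I_N -> R) (z : 'I_N -> K) : (forall i, 0 <= w i) ->
  \sum_i ((Num.sqrt (w i) * re_scalar (z i)) ^+ 2 +
          (Num.sqrt (w i) * im_scalar (z i)) ^+ 2) =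
  \sum_i w i * modulus (z i) ^+ 2.
Proof.
move=> w0; apply: eq_bigr => i _.
by rewrite !exprMn -mulrDr sqr_sqrtr// modulus_sqr.
Qed.

Definition type2_const (r : R) : R := 2 * 2 `^ (r / 2) * khintchine_const r.

Lemma type2_const_ge0 r : 0 <= type2_const r.
Proof.
apply: mulr_ge0; first by rewrite mulr_ge0 ?powR_ge0.
exact: le_trans ler01 (khintchine_const_ge1 r).
Qed.

(** This is where r >= 2 is used: it makes the power r / 2 convex, so that the
    square function is controlled by the r-th powers. *)
Lemma average_signed_mix_powR N (w : 'I_N -> R) (z : 'I_N -> K) r : 2 <= r ->
  (forall i, 0 <= w i) -> \sum_i w i = 1 ->
  average (fun e => modulus (signed_mix w e z) `^ r) <=
  type2_const r * \sum_i w i * modulus (z i) `^ r.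
Proof.
move=> r2 w0 w1; have r0 : 0 < r by lra.
have := @khintchine2_upper _ N (fun i => Num.sqrt (w i) * re_scalar (z i))
  (fun i => Num.sqrt (w i) * im_scalar (z i)) r r0.
rewrite signed_mix_variance//.
under [X in average X <= _ -> _]eq_fun do rewrite -signed_mix_sqr -modulus_powR.
move/le_trans; apply; rewrite ler_wpM2l ?type2_const_ge0//.
apply: le_trans (jensen_powR _ w0 w1 _) _; first by lra.
  by move=> i; exact: sqr_ge0.
by apply: ler_sum => i _; rewrite -modulus_powR.
Qed.

(** Each factor of the geometric mean has its own signs [e j], so that the average of
    the product is the product of the averages. *)
Lemma geomean_signed_mix N n (alpha : 'I_n -> R) (w : 'I_N -> R)
    (z : 'I_n -> 'I_N -> K) :
  (forall j, 0 < alpha j <= 1) -> (forall i, 0 <= w i) ->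
  geomean alpha (fun j => \sum_i w i * modulus (z j i) ^+ 2) <=
  khintchine_lower_const ^+ n * average (fun e : {ffun 'I_n -> {ffun 'I_N -> bool}} =>
    geomean alpha (fun j => modulus (signed_mix w (e j) (z j)) ^+ 2)).
Proof.
move=> a01 w0.
rewrite /geomean (average_prod (fun j (e : {ffun 'I_N -> bool}) =>
  (modulus (signed_mix w e (z j)) ^+ 2) `^ alpha j)).
rewrite -[X in _ ^+ X](card_ord n) -prodr_const -big_split.
apply: ler_prod => j _; rewrite powR_ge0 /=.
have := khintchine2_lower (fun i => Num.sqrt (w i) * re_scalar (z j i))
  (fun i => Num.sqrt (w i) * im_scalar (z j i)) (a01 j).
rewrite signed_mix_variance//.
by under [X in _ <= _ * average X -> _]eq_fun do rewrite -signed_mix_sqr.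
Qed.

(** The type 2 property of L^r, for convex weights and functions in the unit ball. *)
Lemma average_lpnorm_signed_mix d (Y : measurableType d)
    (nu : {measure set Y -> \bar R}) r N (w : 'I_N -> R) (f : 'I_N -> Y -> K) :
  2 <= r -> (forall i, 0 <= w i) -> \sum_i w i = 1 ->
  (forall i, simple_functions nu r%:E (f i)) ->
  (forall i, \int[nu]_y (modulus (f i y) `^ r)%:E <= 1)%E ->
  average (fun e => fine (\int[nu]_y (modulus (signed_mix w e (f ^~ y)) `^ r)%:E))
  <= type2_const r.
Proof.
move=> r2 w0 w1 Sf f1; have r0 : 0 < r by lra.
pose I e := (\int[nu]_y (modulus (signed_mix w e (f ^~ y)) `^ r)%:E)%E.
have Smix e : simple_functions nu r%:E (fun y => signed_mix w e (f ^~ y)).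
  exact: simple_functions_sum.
have mI e : measurable_fun setT (fun y => (modulus (signed_mix w e (f ^~ y)) `^ r)%:E).
  by apply: measurable_modulus_powR; case: (Smix e).
have IE e : I e = (fine (I e))%:E.
  rewrite fineK// ge0_fin_numE; last by apply: integral_ge0 => y _; rewrite lee_fin powR_ge0.
  by apply/(lpnorm_lty _ r0); case: (Smix e).
have mf i : measurable_fun setT (fun y => (modulus (f i y) `^ r)%:E).
  by apply: measurable_modulus_powR; case: (Sf i).
rewrite -lee_fin -/(I _).
have -> : (average (fun e => fine (I e)))%:E =
    (\int[nu]_y (average (fun e => modulus (signed_mix w e (f ^~ y)) `^ r))%:E)%E.
  rewrite /average EFinM -sumEFin; under eq_bigr do rewrite -IE.
  rewrite /I -ge0_integral_sum//; last by move=> e y _; rewrite lee_fin powR_ge0.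
  rewrite -ge0_integralZl_EFin//; last 2 first.
  - by move=> y _; apply: sume_ge0 => e _; rewrite lee_fin powR_ge0.
  - exact: emeasurable_sum.
  by apply: eq_integral => y _; rewrite sumEFin.
apply: (@le_trans _ _ (\int[nu]_y ((type2_const r)%:E *
    \sum_i (w i)%:E * (modulus (f i y) `^ r)%:E))%E).
  apply: ge0_le_integral => //.
  - by move=> y _; rewrite lee_fin average_ge0// => e; exact: powR_ge0.
  - apply/measurable_EFinP; apply: measurable_funM => //.
    by apply: measurable_sum => e; apply/measurable_EFinP; exact: mI.
  - apply: measurable_funeM; apply: emeasurable_sum => i.
    exact: measurable_funeM.
  - move=> y _; under eq_bigr do rewrite -EFinM.
    by rewrite sumEFin -EFinM lee_fin average_signed_mix_powR.
have m0 i y : (0 <= (w i)%:E * (modulus (f i y) `^ r)%:E)%E.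
  by rewrite mule_ge0 ?lee_fin ?powR_ge0.
rewrite ge0_integralZl_EFin//; last 3 first.
- by move=> y _; exact: sume_ge0.
- by apply: emeasurable_sum => i; exact: measurable_funeM.
- exact: type2_const_ge0.
rewrite ge0_integral_sum//; last by move=> i; exact: measurable_funeM.
rewrite -[leRHS]mule1; apply: lee_wpmul2l; first by rewrite lee_fin type2_const_ge0.
rewrite -w1 -sumEFin; apply: lee_sum => i _.
rewrite ge0_integralZl_EFin//; last by move=> y _; rewrite lee_fin powR_ge0.
by rewrite -[leRHS]mule1; apply: lee_wpmul2l; rewrite ?lee_fin.
Qed.

End randomized_combinations.

(** * Hoelder's inequality with a squared factor *)

Section hoelder_square.
Context d (X : measurableType d) (R : realType) (mu : {measure set X -> \bar R}).
Implicit Types (f : X -> \bar R) (G Q : X -> R).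

Lemma Lnorm_infty_ae_le f (y : \bar R) : (Lnorm mu +oo f <= y)%E ->
  {ae mu, forall x, (`|f x| <= y)%E}.
Proof.
rewrite unlock /Lnorm; case: ifPn => [_ /ess_supP//|].
rewrite lt0e measure_ge0 andbT negbK => /eqP mu0 _.
by exists setT; split.
Qed.

Lemma Lnorm_sqr Q (p : R) : 0 < p -> (forall x, 0 <= Q x) ->
  (Lnorm mu p%:E (EFin \o (fun x => Q x ^+ 2)%R) =
   Lnorm mu (2 * p)%:E (EFin \o Q) `^ 2)%E.
Proof.
move=> p0 Q0; rewrite unlock /Lnorm -poweRrM invfM mulrAC mulVf// mul1r.
congr (_ `^ _)%E; apply: eq_integral => x _ /=.
by rewrite !ger0_norm ?sqr_ge0// powRrM powR_mulrn.
Qed.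

(** Hoelder's inequality for Q^2 and G, with exponent q / 2 and its conjugate; since
    ||Q^2||_(q/2) = ||Q||_q^2, only the norm of Q in the hypothesis appears. *)
Lemma hoelder_square (q : \bar R) G Q (b : R) : (2%:E <= q)%E ->
  measurable_fun setT G -> (forall x, 0 <= G x) ->
  (Lnorm mu (hoelder_conjugate (q / 2%:E)) (EFin \o G) < +oo)%E ->
  measurable_fun setT Q -> (forall x, 0 <= Q x) -> 0 <= b ->
  (Lnorm mu q (EFin \o Q) <= b%:E)%E ->
  (\int[mu]_x (G x * Q x ^+ 2)%:E <=
   (b ^+ 2)%:E * Lnorm mu (hoelder_conjugate (q / 2%:E)) (EFin \o G))%E.
Proof.
move=> q2 mG G0 nG mQ Q0 b0 Qb.
have mQ2 : measurable_fun setT (fun x => Q x ^+ 2) by exact: measurable_funX.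
have mGQ : measurable_fun setT (fun x => (G x * Q x ^+ 2)%:E).
  by apply/measurable_EFinP; exact: measurable_funM.
have GQ0 x : (0 <= (G x * Q x ^+ 2)%:E)%E by rewrite lee_fin mulr_ge0 ?sqr_ge0.
have [q_eq2|q_eq2] := eqVneq q 2%:E.
  move: nG Qb; rewrite q_eq2 => nG Qb.
  have conj : hoelder_conjugate (2%:E / 2%:E : \bar R)%E = +oo%E.
    by rewrite inver pnatr_eq0 /= -EFinM divff// hoelder_conjugate1.
  rewrite conj in nG *; set g := Lnorm _ _ _ in nG *.
  have g_fin : g = (fine g)%:E by rewrite fineK// ge0_fin_numE// Lnorm_ge0.
  have := Lnorm_infty_ae_le (lexx g) => aeG.
  have intQ : (\int[mu]_x (Q x ^+ 2)%:E <= (b ^+ 2)%:E)%E.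
    have <- : (Lnorm mu 2%:E (EFin \o Q) `^ 2 = \int[mu]_x (Q x ^+ 2)%:E)%E.
      rewrite poweR_Lnorm//; apply: eq_integral => x _ /=.
      by rewrite ger0_norm// powR_mulrn.
    rewrite -[b ^+ 2]powR_mulrn// -poweR_EFin.
    by apply: gt0_ler_poweR; rewrite ?in_itv/= ?leey ?andbT ?lee_fin// Lnorm_ge0.
  apply: (@le_trans _ _ (\int[mu]_x (g * (Q x ^+ 2)%:E))%E).
    apply: ae_ge0_le_integral => //.
    - by move=> x _; rewrite mule_ge0 ?Lnorm_ge0// lee_fin sqr_ge0.
    - by apply: measurable_funeM; exact/measurable_EFinP.
    - apply: filterS aeG => x /= Gx _.
      rewrite EFinM lee_wpmul2r ?lee_fin ?sqr_ge0//.
      by rewrite ger0_norm// in Gx.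
  rewrite ge0_integralZl//; last 3 first.
  - exact/measurable_EFinP.
  - by move=> x _; rewrite lee_fin sqr_ge0.
  - exact: Lnorm_ge0.
  by rewrite muleC lee_wpmul2r// Lnorm_ge0.
move: q q2 q_eq2 nG Qb => [q||]// q2 q_eq2 nG Qb; last first.
  have conj : hoelder_conjugate (+oo / 2%:E : \bar R)%E = 1%E.
    by rewrite inver pnatr_eq0 /= gt0_mulye ?lte_fin// hoelder_conjugatey.
  rewrite conj Lnorm1 in nG *.
  have aeQ := Lnorm_infty_ae_le Qb.
  apply: (@le_trans _ _ (\int[mu]_x ((b ^+ 2)%:E * `|(EFin \o G) x|))%E).
    apply: ae_ge0_le_integral => //.
    - by move=> x _; rewrite mule_ge0// lee_fin sqr_ge0.
    - apply: measurable_funeM; apply: measurableT_comp => //.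
      exact/measurable_EFinP.
    - apply: filterS aeQ => x /= Qx _.
      rewrite mulrC EFinM ger0_norm// lee_wpmul2r ?lee_fin//.
      by rewrite lee_fin ger0_norm// in Qx; rewrite ler_pXn2r ?nnegrE.
  rewrite ge0_integralZl_EFin//; last 2 first.
  - by apply: measurableT_comp => //; exact/measurable_EFinP.
  - exact: sqr_ge0.
have q_gt2 : 2 < q.
  by rewrite lt_neqAle -lee_fin q2 andbT eq_sym; apply: contra q_eq2 => /eqP ->.
pose p := q / 2; have p1 : 1 < p by rewrite /p; lra.
pose p' := p / (p - 1); have p'0 : 0 < p' by rewrite divr_gt0//; lra.
have conj : hoelder_conjugate (q%:E / 2%:E : \bar R)%E = p'%:E.
  rewrite inver pnatr_eq0 /= -EFinM -/p /hoelder_conjugate /=.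
  rewrite eqe gt_eqF; last by lra.
  rewrite -EFinD inver gt_eqF; last by lra.
  by rewrite -EFinM.
rewrite conj in nG *.
have pp' : p^-1 + p'^-1 = 1 by rewrite /p'; field; apply/andP; split; lra.
have p0 : 0 < p by lra.
have := hoelder mu mQ2 mG p0 p'0 pp'.
rewrite Lnorm1 Lnorm_sqr// (_ : 2 * p = q); last by rewrite /p; lra.
rewrite (eq_integral (fun x => (G x * Q x ^+ 2)%:E)) => [|x _]; last first.
  by rewrite /= ger0_norm ?mulr_ge0 ?sqr_ge0// mulrC.
move/le_trans; apply; rewrite lee_wpmul2r ?Lnorm_ge0//.
rewrite -[b ^+ 2]powR_mulrn// -poweR_EFin.
by apply: gt0_ler_poweR; rewrite ?in_itv/= ?leey ?andbT ?lee_fin// Lnorm_ge0.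
Qed.

End hoelder_square.

(** * The bound for square functions *)

Section vector_valued.
Context {R : realType} {k : scalars} {n : nat}.
Variables (alpha : 'I_n -> R) (q : \bar R) (r : 'I_n -> R).
Hypothesis alpha_gt0 : forall j, 0 < alpha j.
Hypothesis alpha_sum1 : \sum_(j < n) alpha j = 1.
Hypothesis q_ge2 : (2%:E <= q)%E.
Hypothesis r_ge2 : forall j, 2 <= r j.
Context dX (X : measurableType dX) (mu : {measure set X -> \bar R}).
Context (dY : 'I_n -> measure_display) (Y : forall j, measurableType (dY j)).
Variable nu : forall j, {measure set (Y j) -> \bar R}.
Variable T : forall j, (Y j -> scalar_field R k) -> (X -> scalar_field R k).
Arguments T : clear implicits.
Local Notation S j := (simple_functions (nu j) (r j)%:E).
Hypothesis linT : forall j, linear_operator mu (S j) (T j).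
Variable B : R.
Hypothesis B_ge0 : 0 <= B.
Hypothesis multilinear_bound : forall f : forall j, Y j -> scalar_field R k,
  (forall j, S j (f j)) ->
  (Lnorm mu q (fun x => (\prod_(j < n) modulus (T j (f j) x) `^ alpha j)%:E)
   <= B%:E * \prod_(j < n) (lpnorm (nu j) (r j)%:E (f j) `^ alpha j))%E.
Variable G : X -> R.
Hypothesis mG : measurable_fun setT G.
Hypothesis G0 : forall x, 0 <= G x.
Local Notation normG := (Lnorm mu (hoelder_conjugate (q / 2%:E)) (EFin \o G)).
Hypothesis nG : (normG < +oo)%E.

Let alpha_le1 j : 0 < alpha j <= 1.
Proof.
rewrite alpha_gt0 -alpha_sum1 (bigD1 j)//= lerDl sumr_ge0// => i _; exact: ltW.
Qed.

Let r_gt0 j : 0 < r j. Proof. by have := r_ge2 j; lra. Qed.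

Let prod_EFin_lpnorm (f : forall j, Y j -> scalar_field R k) :
  (forall j, S j (f j)) ->
  (\prod_(j < n) (lpnorm (nu j) (r j)%:E (f j) `^ alpha j))%E =
  (\prod_(j < n) fine (lpnorm (nu j) (r j)%:E (f j)) `^ alpha j)%:E.
Proof.
move=> Sf; rewrite (big_morph EFin (@EFinM _) erefl); apply: eq_bigr => j _.
rewrite -poweR_EFin fineK// ge0_fin_numE; last exact: Lnorm_ge0.
by case: (Sf j).
Qed.

Let measurable_T j f : S j f -> measurable_fun setT (fun x => modulus (T j f x)).
Proof. by move=> Sf; apply: measurable_modulus; exact: (linT j).1. Qed.

(** The factors ||f_j||^(2 alpha_j) are at most 1 + ||f_j||^(r_j), because
    2 alpha_j <= 2 <= r_j. The integrals of |f_j|^(r_j) that result can be averaged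
    over signs. *)
Lemma weighted_multilinear_bound (f : forall j, Y j -> scalar_field R k) :
  (forall j, S j (f j)) ->
  (\int[mu]_x (G x * geomean alpha (fun j => modulus (T j (f j) x) ^+ 2))%:E <=
   (B ^+ 2 * \prod_j (1 + fine (\int[nu j]_y (modulus (f j y) `^ r j)%:E)))%:E
   * normG)%E.
Proof.
move=> Sf; pose Q x := \prod_(j < n) modulus (T j (f j) x) `^ alpha j.
have mQ : measurable_fun setT Q.
  apply: (@measurable_geomean _ _ _ _ alpha (fun j x => modulus (T j (f j) x))) => j.
  exact: measurable_T.
have Q0 x : 0 <= Q x by apply: prodr_ge0 => j _; exact: powR_ge0.
have QE x : geomean alpha (fun j => modulus (T j (f j) x) ^+ 2) = Q x ^+ 2.
  rewrite /Q expr2 -big_split; apply: eq_bigr => j _ /=.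
  by rewrite expr2 powRM ?modulus_ge0.
under eq_integral do rewrite QE.
pose b := B * \prod_(j < n) fine (lpnorm (nu j) (r j)%:E (f j)) `^ alpha j.
have b0 : 0 <= b.
  by rewrite mulr_ge0// prodr_ge0// => j _; exact: powR_ge0.
have Qb : (Lnorm mu q (EFin \o Q) <= b%:E)%E.
  by have := multilinear_bound Sf; rewrite prod_EFin_lpnorm// -EFinM.
apply: (le_trans (hoelder_square q_ge2 mG G0 nG mQ Q0 b0 Qb)).
rewrite lee_wpmul2r ?Lnorm_ge0// lee_fin exprMn ler_wpM2l ?sqr_ge0//.
rewrite expr2 -big_split; apply: ler_prod => j _ /=.
rewrite mulr_ge0 ?powR_ge0//=; set u := fine (lpnorm _ _ _).
have u0 : 0 <= u by apply: fine_ge0; exact: Lnorm_ge0.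
rewrite -(lpnorm_powR (nu j) (r_gt0 j)) fine_poweR -/u.
have [u1|u1] := lerP u 1.
  rewrite (@le_trans _ _ 1) ?lerDl ?powR_ge0//.
  have ua : u `^ alpha j <= 1.
    rewrite [leRHS](_ : _ = 1 `^ alpha j); last by rewrite powR1.
    by apply: ge0_ler_powR => //; [exact: ltW|rewrite nnegrE].
  by rewrite mulr_ile1 ?powR_ge0.
rewrite -powRD; last by apply/implyP => _; rewrite gt_eqF//; lra.
apply: (@le_trans _ _ (u `^ r j)); last by rewrite lerDr.
apply: ler_powR; first exact: ltW.
by have := r_ge2 j; have /andP[_] := alpha_le1 j; lra.
Qed.

Definition duality_const : R :=
  khintchine_lower_const ^+ n * \prod_j (1 + type2_const (r j)).

Lemma square_function_bound N (w : 'I_N -> R)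
    (a : 'I_N -> forall j, Y j -> scalar_field R k) :
  (forall i, 0 <= w i) -> \sum_i w i = 1 ->
  (forall i j, S j (a i j)) ->
  (forall i j, \int[nu j]_y (modulus (a i j y) `^ r j)%:E <= 1)%E ->
  (\int[mu]_x (G x * geomean alpha (fun j =>
      \sum_i w i * modulus (T j (a i j) x) ^+ 2))%:E <=
   (duality_const * B ^+ 2)%:E * normG)%E.
Proof.
move=> w0 w1 Sa a1.
(* one family of signs for each operator, drawn independently *)
pose E := {ffun 'I_n -> {ffun 'I_N -> bool}}.
pose mix (e : E) j : Y j -> scalar_field R k := fun y =>
  signed_mix w (e j) (fun i => a i j y).
have Smix e j : S j (mix e j) by exact: simple_functions_sum.
pose P (e : E) x := G x * geomean alpha (fun j => modulus (T j (mix e j) x) ^+ 2).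
have P0 e x : 0 <= P e x by rewrite mulr_ge0// geomean_ge0.
have mP e : measurable_fun setT (P e).
  apply: measurable_funM => //; apply: measurable_geomean => j.
  by apply: measurable_funX; exact: measurable_T.
have Tmix : {ae mu, forall x, forall e j,
    T j (mix e j) x = signed_mix w (e j) (fun i => T j (a i j) x)}.
  apply: filter_forall => e; apply: filter_forall => j.
  exact: (linear_operator_sum (r_gt0 j) (linT j) _ (fun i => Sa i j)).
have L0 : 0 <= khintchine_lower_const ^+ n :> R.
  by rewrite exprn_ge0// khintchine_lower_const_ge0.
have aeP : {ae mu, forall x, G x * geomean alpha (fun j =>
      \sum_i w i * modulus (T j (a i j) x) ^+ 2) <=
    khintchine_lower_const ^+ n * average (P ^~ x)}.
  apply: filterS Tmix => x Tx.
  have := geomean_signed_mix (fun j i => T j (a i j) x) alpha_le1 w0.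
  move/(ler_wpM2l (G0 x))/le_trans; apply; rewrite mulrCA ler_wpM2l//.
  rewrite -averageZ; apply: ler_average => e.
  rewrite /P [X in _ <= _ * geomean _ X](_ : _ = (fun j =>
    modulus (signed_mix w (e j) (fun i => T j (a i j) x)) ^+ 2))//.
  by apply/funext => j; rewrite Tx.
have mT i j : measurable_fun setT (fun x => modulus (T j (a i j) x) ^+ 2).
  by apply: measurable_funX; exact: measurable_T.
pose c : R := #|{: E}|%:R^-1.
have c0 : 0 <= c by rewrite invr_ge0.
apply: (@le_trans _ _ (\int[mu]_x ((khintchine_lower_const ^+ n * c)%:E *
    \sum_(e : E) (P e x)%:E))%E).
  apply: ae_ge0_le_integral => //.
  - by move=> x _; rewrite lee_fin mulr_ge0// geomean_ge0.
  - apply/measurable_EFinP; apply: measurable_funM => //.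
    apply: measurable_geomean => j; apply: measurable_sum => i.
    exact: measurable_funM.
  - move=> x _; rewrite mule_ge0//; first by rewrite lee_fin mulr_ge0.
    by apply: sume_ge0 => e _; rewrite lee_fin.
  - by apply: measurable_funeM; apply: emeasurable_sum => e; exact/measurable_EFinP.
  - apply: filterS aeP => x + _; rewrite /average -/E -/c.
    by rewrite sumEFin -EFinM lee_fin mulrA.
rewrite ge0_integralZl_EFin//; last 3 first.
- by move=> x _; apply: sume_ge0 => e _; rewrite lee_fin.
- by apply: emeasurable_sum => e; exact/measurable_EFinP.
- exact: mulr_ge0.
rewrite ge0_integral_sum//; last 2 first.
- by move=> e; exact/measurable_EFinP.
- by move=> e x _; rewrite lee_fin.
have normG_fin : normG = (fine normG)%:E by rewrite fineK// ge0_fin_numE// Lnorm_ge0.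
pose I j e := fine (\int[nu j]_y (modulus (signed_mix w e (fun i => a i j y)) `^ r j)%:E).
apply: (@le_trans _ _ ((khintchine_lower_const ^+ n * c)%:E *
    \sum_(e : E) ((B ^+ 2 * \prod_j (1 + I j (e j)))%:E * normG))%E).
  apply: lee_wpmul2l; first by rewrite lee_fin mulr_ge0.
  by apply: lee_sum => e _; exact: (weighted_multilinear_bound (Smix e)).
rewrite normG_fin; under eq_bigr do rewrite -EFinM.
rewrite sumEFin -!EFinM lee_fin -mulr_suml mulrA ler_wpM2r//.
  exact/fine_ge0/Lnorm_ge0.
rewrite /duality_const -!mulrA ler_wpM2l// -mulr_sumr mulrCA.
rewrite [leRHS]mulrC ler_wpM2l ?sqr_ge0//.
rewrite -/(average (fun e : E => \prod_j (1 + I j (e j)))).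
rewrite (average_prod (fun j e => 1 + I j e)).
have I0 j e : 0 <= I j e.
  by apply: fine_ge0; apply: integral_ge0 => y _; rewrite lee_fin powR_ge0.
apply: ler_prod => j _; rewrite average_ge0/= => [|e]; last by rewrite addr_ge0.
rewrite averageD lerD//.
  rewrite /average sumr_const -[_ *+ _]mulr_natl mulr1 mulVf// pnatr_eq0 -lt0n.
  by apply/card_gt0P; exists [ffun=> true].
exact: (average_lpnorm_signed_mix (r_ge2 j) w0 w1).
Qed.

End vector_valued.

(** * Weights for finitely many tuples *)

Section near_optimizer.
Context d (X : measurableType d) (R : realType) (n N : nat).
Variable mu : {measure set X -> \bar R}.
Variable alpha : 'I_n -> R.
Hypothesis alpha_gt0 : forall j, 0 < alpha j.
Hypothesis alpha_sum1 : \sum_j alpha j = 1.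
Variables (F : 'I_N.+1 -> 'I_n -> X -> R) (G : X -> R) (M : R).
Hypothesis mF : forall a j, measurable_fun setT (F a j).
Hypothesis F0 : forall a j x, 0 <= F a j x.
Hypothesis mG : measurable_fun setT G.
Hypothesis G0 : forall x, 0 <= G x.
Hypothesis M0 : 0 < M.

Let mix (w : 'I_N.+1 -> R) j x := \sum_a w a * F a j x.

Hypothesis le_M : forall w : 'I_N.+1 -> R, (forall a, 0 <= w a) -> \sum_a w a = 1 ->
  (\int[mu]_x (G x * geomean alpha (mix w ^~ x))%:E <= M%:E)%E.

(* half of the uniform weight, so that a vertex can be pulled halfway to the
   centre of the simplex and stay above it *)
Let tau : R := (2 * N.+1%:R)^-1.

Let tau_gt0 : 0 < tau. Proof. by rewrite invr_gt0 mulr_gt0. Qed.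

Let D (w : 'I_N.+1 -> R) := (forall a, tau <= w a) /\ \sum_a w a = 1.

Let D_ge0 w : D w -> forall a, 0 <= w a.
Proof. by move=> [wt _] a; exact: le_trans (ltW tau_gt0) (wt a). Qed.

Let mix_ge0 w j x : (forall a, 0 <= w a) -> 0 <= mix w j x.
Proof. by move=> w0; apply: sumr_ge0 => a _; rewrite mulr_ge0. Qed.

Let measurable_mix w j : measurable_fun setT (mix w j).
Proof. by apply: measurable_sum => a; exact: measurable_funM. Qed.

Let measurable_geomix w : measurable_fun setT (fun x => geomean alpha (mix w ^~ x)).
Proof.
exact: measurable_geomean.
Qed.

Let Phi w : \bar R := \int[mu]_x (G x * geomean alpha (mix w ^~ x))%:E.

Let integrand_ge0 w x : 0 <= G x * geomean alpha (mix w ^~ x).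
Proof. by rewrite mulr_ge0// geomean_ge0. Qed.

Let Phi_ge0 w : (0 <= Phi w)%E.
Proof. by apply: integral_ge0 => x _; rewrite lee_fin. Qed.

Let Phi_fin w : D w -> Phi w = (fine (Phi w))%:E.
Proof.
move=> Dw; rewrite fineK// ge0_fin_numE//.
by rewrite (le_lt_trans (le_M (D_ge0 Dw) Dw.2))// ltry.
Qed.

Let Phi_le w : D w -> fine (Phi w) <= M.
Proof. by move=> Dw; rewrite -lee_fin -Phi_fin// le_M//; [exact: D_ge0|exact: Dw.2]. Qed.

(* the vertex [a] of the simplex, pulled halfway to the centre *)
Let tip (a b : 'I_N.+1) : R := 2^-1 * (b == a)%:R + tau.

Let D_tip a : D (tip a).
Proof.
split=> [b|]; first by rewrite lerDr mulr_ge0.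
rewrite big_split /= -mulr_sumr (bigD1 a)//= eqxx big1 => [|b /negbTE->//].
rewrite addr0 mulr1 sumr_const card_ord.
have -> : tau *+ N.+1 = 2^-1
  by rewrite -[tau *+ _]mulr_natr /tau invfM -mulrA mulVf ?mulr1.
by lra.
Qed.

Let S : R := sup [set fine (Phi w) | w in D].

Let D_sup : has_sup [set fine (Phi w) | w in D].
Proof.
split; first by exists (fine (Phi (tip ord0))), (tip ord0).
by exists M => _ [w Dw <-]; exact: Phi_le.
Qed.

Let S_le : S <= M.
Proof. by apply: ge_sup; [exact: D_sup.1|move=> _ [w Dw <-]; exact: Phi_le]. Qed.

Let Phi_perturb w v : D w -> D v ->
  (Phi (fun a => w a + tau * v a)%R <= ((1 + tau) * S)%:E)%E.
Proof.
move=> Dw Dv; have t1 : 0 < 1 + tau by rewrite ltr_pwDl// ltW.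
pose u a := (1 + tau)^-1 * (w a + tau * v a).
have Du : D u.
  split=> [a|].
    rewrite /u mulrC ler_pdivlMr// mulrDr mulr1 lerD//; first exact: Dw.1.
    by rewrite ler_wpM2l ?(ltW tau_gt0)//; exact: Dv.1.
  by rewrite -mulr_sumr big_split /= -mulr_sumr Dw.2 Dv.2 mulr1 mulVf// gt_eqF.
have -> : Phi (fun a => w a + tau * v a) = ((1 + tau)%:E * Phi u)%E.
  rewrite /Phi -ge0_integralZl_EFin//; last 3 first.
  - by move=> x _; rewrite lee_fin.
  - apply/measurable_EFinP; apply: measurable_funM => //.
  - exact: ltW.
  apply: eq_integral => x _; rewrite -EFinM; congr EFin.
  rewrite mulrCA -(@geomeanZ _ _ alpha (1 + tau) (mix u ^~ x)) ?(ltW t1)//; last first.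
    by move=> j; apply: mix_ge0; exact: D_ge0.
  congr (_ * geomean _ _); apply/funext => j.
  rewrite /mix mulr_sumr; apply: eq_bigr => a _; rewrite /u.
  by rewrite -!mulrA mulVKf// gt_eqF.
rewrite Phi_fin// -EFinM lee_fin ler_wpM2l ?(ltW t1)//.
by apply: ub_le_sup; [exact: D_sup.2|exists u].
Qed.

(** Let [w] maximise Phi up to tau * M over the weights that are at least [tau],
    and let P be the integrand of Phi at [w]. Moving from [w] by tau towards the
    point [tip a] stays in this set after normalisation, so Phi increases by at
    most tau * S + tau * M <= 2 tau M. As every coefficient of [w] is at least
    tau and those of v = tip a are at most 1, tau * mix v is at most mix w, and
    [geomean_perturb] bounds the increase from below by half of its linear part
    sum_j alpha_j tau int (P / mix w_j) mix v_j. Since mix v >= F a / 2, the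
    weights g_j = P / mix w_j satisfy the bound with the constant 8. *)
Lemma near_optimizer_weights : exists g : 'I_n -> X -> R,
  [/\ forall j, measurable_fun setT (g j),
      forall j x, 0 <= g j x,
      forall a j, ((alpha j)%:E * \int[mu]_x (F a j x * g j x)%:E <= (8 * M)%:E)%E &
      forall a x, (forall j, 0 < F a j x) -> G x <= geomean alpha (g ^~ x)].
Proof.
have tM : 0 < tau * M by rewrite mulr_gt0.
have [_ [w Dw <-] wS] := sup_adherent tM D_sup.
have w0 := D_ge0 Dw.
pose P x := G x * geomean alpha (mix w ^~ x).
have P0 x : 0 <= P x by exact: integrand_ge0.
have mP : measurable_fun setT P by apply: measurable_funM.
pose g j x := P x / mix w j x.
have g0 j x : 0 <= g j x by rewrite divr_ge0// mix_ge0.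
have mg j : measurable_fun setT (g j).
  rewrite (_ : g j = fun x => P x * mix w j x `^ (-1)); last first.
    by apply/funext => x; rewrite powR_inv1// mix_ge0.
  apply: measurable_funM => //.
  exact: (@measurableT_comp _ _ _ _ _ _ (@powR R ^~ (-1))).
exists g; split => //.
- move=> a i; pose v := tip a; have Dv : D v by exact: D_tip.
  have v0 := D_ge0 Dv.
  have v1 b : v b <= 1.
    rewrite -Dv.2 (bigD1 b)//= lerDl sumr_ge0// => c _; exact: v0.
  have wv j x : 0 <= tau * mix v j x <= mix w j x.
    rewrite mulr_ge0 ?(ltW tau_gt0) ?mix_ge0//= /mix mulr_sumr.
    apply: ler_sum => b _; rewrite mulrA ler_wpM2r//.
    apply: le_trans (Dw.1 b); rewrite ler_piMr// ltW//.
  pose Q x := \sum_j (alpha j * tau / 2) * (g j x * mix v j x).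
  have Q0 x : 0 <= Q x.
    apply: sumr_ge0 => j _; rewrite mulr_ge0//.
      by rewrite divr_ge0// mulr_ge0 ?(ltW tau_gt0) ?(ltW (alpha_gt0 j)).
    by rewrite mulr_ge0 ?mix_ge0.
  have mQ : measurable_fun setT Q.
    apply: measurable_sum => j; apply: measurable_funM => //.
    by apply: measurable_funM => //; exact: measurable_mix.
  have PQ x : P x + Q x <= G x * geomean alpha (mix (fun b => w b + tau * v b) ^~ x).
    have mixD j : mix (fun b => w b + tau * v b) j x = mix w j x + tau * mix v j x.
      rewrite /mix mulr_sumr -big_split; apply: eq_bigr => b _.
      by rewrite mulrDl mulrA.
    (* where some mix w_j vanishes, P and all g_j vanish too *)
    have [w_gt0|] := pselect (forall j, 0 < mix w j x).
      have := geomean_perturb alpha_gt0 w_gt0 (wv ^~ x).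
      under [X in _ <= geomean _ X]eq_fun do rewrite -mixD.
      move=> /(ler_wpM2l (G0 x)); apply: le_trans.
      rewrite mulrA -/(P x) mulrDr mulr1 lerD2l /Q mulr_sumr.
      by apply: ler_sum => j _; rewrite /g le_eqVlt; apply/orP; left; apply/eqP; ring.
    move=> /existsNP[j /negP]; rewrite -leNgt => wj.
    have wj0 : mix w j x = 0 by apply/eqP; rewrite eq_le wj mix_ge0.
    have Px : P x = 0 by rewrite /P (@geomean_eq0 _ _ _ _ j)// mulr0.
    rewrite Px add0r /Q big1 => [|k _]; first exact: integrand_ge0.
    by rewrite /g Px !mul0r mulr0.
  have intQ : (\int[mu]_x (Q x)%:E <= (2 * tau * M)%:E)%E.
    have : (Phi w + \int[mu]_x (Q x)%:E <= ((1 + tau) * S)%:E)%E.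
      apply: le_trans (Phi_perturb Dw Dv).
      rewrite /Phi -ge0_integralD//; last 4 first.
      - by move=> x _; rewrite lee_fin.
      - exact/measurable_EFinP.
      - by move=> x _; rewrite lee_fin.
      - exact/measurable_EFinP.
      apply: ge0_le_integral => //.
      - by move=> x _; rewrite -EFinD lee_fin addr_ge0.
      - by apply/measurable_EFinP; exact: measurable_funD.
      - by apply/measurable_EFinP; exact: measurable_funM.
      - by move=> x _; rewrite -EFinD lee_fin; exact: PQ.
    have : (0 <= \int[mu]_x (Q x)%:E)%E by apply: integral_ge0 => x _; rewrite lee_fin.
    rewrite Phi_fin//; case: (\int[mu]_x _)%E => [q _|//|//].
    rewrite -EFinD !lee_fin => h; have := ler_wpM2l (ltW tau_gt0) S_le.
    move: h wS; rewrite -/S mulrDl mul1r -mulrA.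
    by move: (tau * S) (tau * M) => x y; lra.
  have mFg : measurable_fun setT (fun x => (F a i x * g i x)%:E).
    by apply/measurable_EFinP; exact: measurable_funM.
  have : ((alpha i * tau / 4)%:E * \int[mu]_x (F a i x * g i x)%:E <= (2 * tau * M)%:E)%E.
    apply: le_trans intQ.
    have c0 : 0 <= alpha i * tau / 4.
      by rewrite divr_ge0// mulr_ge0 ?(ltW tau_gt0) ?(ltW (alpha_gt0 i)).
    rewrite -ge0_integralZl_EFin//; last by move=> x _; rewrite lee_fin mulr_ge0.
    apply: ge0_le_integral => //.
    - by move=> x _; rewrite -EFinM lee_fin mulr_ge0// mulr_ge0.
    - by apply/measurable_EFinP; apply: measurable_funM => //; exact/measurable_EFinP.
    - exact/measurable_EFinP.
    - move=> x _; rewrite -EFinM lee_fin /Q (bigD1 i)//= -[leLHS]addr0 lerD//; last first.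
        apply: sumr_ge0 => j _; rewrite mulr_ge0//.
          by rewrite divr_ge0// mulr_ge0 ?(ltW tau_gt0) ?(ltW (alpha_gt0 j)).
        by rewrite mulr_ge0 ?mix_ge0.
      have Fv : F a i x <= 2 * mix v i x.
        rewrite /mix (bigD1 a)//= /v /tip eqxx mulr1 mulrDr.
        have : 0 <= \sum_(b | b != a) (2^-1 * (b == a)%:R + tau) * F b i x.
          by apply: sumr_ge0 => b _; rewrite mulr_ge0// addr_ge0 ?(ltW tau_gt0)// mulr_ge0.
        have := F0 a i x; have := tau_gt0; set s := \sum_(_ | _) _; set t := tau; nra.
      have -> : alpha i * tau / 4 * (F a i x * g i x) =
          alpha i * tau / 2 * (g i x * (F a i x / 2)) by field.
      apply: ler_wpM2l.
        by rewrite divr_ge0// mulr_ge0 ?(ltW tau_gt0) ?(ltW (alpha_gt0 i)).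
      by rewrite ler_wpM2l//; lra.
  have : (0 <= \int[mu]_x (F a i x * g i x)%:E)%E.
    by apply: integral_ge0 => x _; rewrite lee_fin mulr_ge0.
  have := alpha_gt0 i; have := tau_gt0; set t := tau; set al := alpha i.
  case: (\int[mu]_x _)%E => [I||]//= t0 al0.
    rewrite !lee_fin => I0.
    have -> : al * t / 4 * I = t * (al * I / 4) by field.
    rewrite [2 * t]mulrC -[t * 2 * M]mulrA (ler_pM2l t0).
    by move: (al * I) => y; lra.
  by rewrite gt0_muley ?lte_fin ?divr_gt0 ?mulr_gt0.
- move=> a x Fx.
  have w_gt0 j : 0 < mix w j x.
    rewrite /mix (bigD1 a)//= ltr_pwDl//.
      by rewrite mulr_gt0//; exact: lt_le_trans tau_gt0 (Dw.1 a).
    by apply: sumr_ge0 => b _; rewrite mulr_ge0.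
  have geo0 := geomean_gt0 alpha w_gt0.
  rewrite -(ler_pM2r geo0) -geomeanM// => [|j]; last exact: ltW.
  rewrite (_ : (fun j => g j x * mix w j x) = fun=> P x); last first.
    by apply/funext => j; rewrite /g divfK// gt_eqF.
  by rewrite geomean_cst.
Qed.

End near_optimizer.

(** * Almost everywhere bounds from geometrically small integrals *)

Section finite_measure.
Context d (X : measurableType d) (R : realType).

Lemma nneseries_geometric_half : (\sum_(0 <= k <oo) (2^-1 ^+ k)%:E)%E = 2%:E :> \bar R.
Proof.
apply: cvg_lim => //.
rewrite (_ : (fun _ => _) = EFin \o series (geometric 1 2^-1)); last first.
  apply/funext => n /=; rewrite /series /= -sumEFin.
  by under [in RHS]eq_bigr do rewrite mul1r.
apply: cvg_EFin; first exact: nearW.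
have := @cvg_geometric_series R 1 2^-1.
rewrite ger0_norm ?invr_ge0// => /(_ ltac:(lra)).
by rewrite (_ : 1 - 2^-1 = 2^-1) ?div1r ?invrK//; lra.
Qed.

(** On a finite measure the energies below are finite; only null sets have to be
    carried back. *)
Lemma sigma_finite_equiv_finite (mu : {sigma_finite_measure set X -> \bar R}) :
  exists m : {measure set X -> \bar R},
    (m setT < +oo)%E /\ forall A, measurable A -> m A = 0%E -> mu A = 0%E.
Proof.
have [F UF mF] := sigma_finiteT mu.
have mFn n := (mF n).1; have fin n := (mF n).2.
have c0 n : 0 < 2^-1 ^+ n / (1 + fine (mu (F n))).
  by rewrite divr_gt0 ?exprn_gt0 ?invr_gt0// ltr_pwDl// fine_ge0.
have c0' n : 0 <= 2^-1 ^+ n / (1 + fine (mu (F n))) by exact: ltW.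
pose m_ n : {measure set X -> \bar R} :=
  mscale (NngNum (c0' n)) (mrestr mu (mFn n)).
have m_E n A : m_ n A =
  ((2^-1 ^+ n / (1 + fine (mu (F n))))%:E * mu (A `&` F n))%E by [].
exists (mseries m_ 0); split => [|A mA].
  apply: (@le_lt_trans _ _ (\sum_(0 <= k <oo) (2^-1 ^+ k)%:E)%E).
    apply: lee_nneseries => [k _ _|k _]; first exact: measure_ge0.
    rewrite m_E setTI.
    rewrite -(fineK (_ : mu (F k) \is a fin_num)) ?ge0_fin_numE ?fin//=.
    have := fine_ge0 (measure_ge0 mu (F k)); set x := fine _ => x0.
    rewrite lee_fin -mulrA ler_piMr ?exprn_ge0//.
    by rewrite mulrC ler_pdivrMr ?mul1r ?lerDr// ltr_pwDl.
  by rewrite nneseries_geometric_half ltry.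
move=> mA0.
have muAF k : mu (A `&` F k) = 0%E.
  have : m_ k A = 0%E.
    apply/eqP; rewrite eq_le measure_ge0 andbT -mA0 /mseries.
    rewrite [leRHS](@nneseriesD1 R (fun i => m_ i A) k xpredT)// ?leeDl//.
    by apply: nneseries_ge0 => *; exact: measure_ge0.
  rewrite m_E => /eqP; rewrite mule_eq0 => /orP[|/eqP//].
  by rewrite eqe gt_eqF.
rewrite -(setIT A) UF setI_bigcupr; apply: measure_negligible.
  by apply: bigcup_measurable => k _; exact: measurableI.
by apply: negligible_bigcup => k; exists (A `&` F k); split;
  [exact: measurableI|exact: muAF|].
Qed.


Lemma ae_transfer (mu m : {measure set X -> \bar R}) (P : X -> Prop) :
  (forall A, measurable A -> m A = 0%E -> mu A = 0%E) ->
  {ae m, forall x, P x} -> {ae mu, forall x, P x}.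
Proof. by move=> mmu [N [mN N0 sN]]; exists N; split => //; exact: mmu. Qed.

(** The sum of 4^n u_n^2 has finite integral, so it is finite almost everywhere, and
    it bounds each of its terms. *)
Lemma ae_geometric_decay (m : {measure set X -> \bar R}) (u : nat -> X -> R) :
  (forall n, measurable_fun setT (u n)) ->
  (forall n, \int[m]_x (u n x ^+ 2)%:E <= (8^-1 ^+ n)%:E)%E ->
  {ae m, forall x, exists K, forall n, `|u n x| <= K * 2^-1 ^+ n}.
Proof.
move=> mu_ iu; pose f n x : \bar R := (4 ^+ n * u n x ^+ 2)%:E.
have f0 n x : (0 <= f n x)%E by rewrite lee_fin mulr_ge0 ?sqr_ge0 ?exprn_ge0.
have mf n : measurable_fun setT (f n).
  by apply/measurable_EFinP; apply: measurable_funM => //; exact: measurable_funX.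
pose S x : \bar R := (\sum_(0 <= n <oo) f n x)%E.
have S0 x : (0 <= S x)%E by exact: nneseries_ge0.
have iS : m.-integrable setT S.
  apply/integrableP; split; first exact: ge0_emeasurable_sum.
  under eq_integral do rewrite gee0_abs//.
  rewrite /S integral_nneseries//.
  apply: (@le_lt_trans _ _ 2%:E); last exact: ltry.
  rewrite -nneseries_geometric_half; apply: lee_nneseries => n _.
    by move=> _; exact: integral_ge0.
  rewrite /f; under eq_integral do rewrite EFinM.
  rewrite ge0_integralZl_EFin//; last 2 first.
  - by move=> x _; rewrite lee_fin sqr_ge0.
  - by apply/measurable_EFinP; exact: measurable_funX.
  apply: (le_trans (lee_wpmul2l _ (iu n))); first by rewrite lee_fin exprn_ge0.
  by rewrite -EFinM lee_fin -exprMn (_ : 4 * 8^-1 = 2^-1)//; lra.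
have := integrable_ae measurableT iS; apply: filterS => x /(_ I) Sfin.
exists (Num.sqrt (fine (S x))) => n.
have fS : (f n x <= S x)%E.
  by rewrite /S (@nneseriesD1 _ (f ^~ x) n xpredT)// leeDl// nneseries_ge0.
have {fS} : 4 ^+ n * u n x ^+ 2 <= fine (S x) by rewrite -lee_fin fineK.
move=> h; have -> : `|u n x| = Num.sqrt (4 ^+ n * u n x ^+ 2) * 2^-1 ^+ n.
  rewrite sqrtrM ?exprn_ge0// sqrtr_sqr (_ : 4 = 2 ^+ 2); last by lra.
  rewrite exprAC sqrtr_sqr normrX normr_nat mulrAC -exprMn divff// expr1n.
  by rewrite mul1r.
by rewrite ler_wpM2r ?exprn_ge0 ?invr_ge0// ler_wsqrtr.
Qed.

End finite_measure.

(** * Compactness of convex sets of nonnegative functions *)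

Section exp_convergence.
Context {R : realType}.

(** The inverse of h |-> exp (- h / 2), extended to send 0 to infinity. *)
Definition neg2ln (s : R) : \bar R := if s == 0 then +oo%E else (- 2 * ln s)%:E.

Lemma cvg_exp_half_neg2ln (h : nat -> R) (s : R) :
  expR (- h n / 2) @[n --> \oo] --> s -> (h n)%:E @[n --> \oo] --> neg2ln s.
Proof.
move=> hs; have s0 : 0 <= s.
  by apply: (cvgr_to_ge hs); apply: nearW => n; exact: expR_ge0.
rewrite /neg2ln; case: ifPn => [/eqP s00|sN0].
  apply/cvgeyPge => A; move/cvgr_lt : hs => /(_ (expR (- A / 2))).
  rewrite s00 => /(_ (expR_gt0 _)); apply: filterS => n.
  by rewrite ltr_expR lee_fin; lra.
apply: cvg_EFin; first exact: nearW.
rewrite (_ : fine \o _ = (fun n => - 2 * ln (expR (- h n / 2)))); last first.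
  by apply/funext => n /=; rewrite expRK; lra.
apply: cvgMr; apply: continuous_cvg hs.
by apply: continuous_ln; rewrite lt_neqAle eq_sym sN0.
Qed.

Lemma geometric_decay_cvg (s : nat -> R) (K : R) :
  (forall n, `|s n - s n.+1| <= K * 2^-1 ^+ n) -> cvgn s.
Proof.
move=> sK; have K0 : 0 <= K by have := sK 0%N; rewrite expr0 mulr1; exact: le_trans.
have cs : cvgn (series (fun n => s n.+1 - s n)).
  apply: normed_cvg; apply: (@series_le_cvg _ _ (geometric K 2^-1)).
  - by move=> n /=; exact: normr_ge0.
  - by move=> n; rewrite /geometric /= mulr_ge0// exprn_ge0.
  - by move=> n /=; rewrite distrC.
  - by apply: is_cvg_geometric_series; rewrite ger0_norm//; lra.
rewrite (_ : s = (fun n => series (fun n => s n.+1 - s n) n + s 0%N)); last first.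
  by apply/funext => n; rewrite /series /= telescope_sumr// subrK.
by apply: is_cvgD => //; exact: is_cvg_cst.
Qed.

Lemma geometric_decay_cvg0 (u : nat -> R) (K : R) :
  (forall n, `|u n| <= K * 2^-1 ^+ n) -> u @ \oo --> (0 : R).
Proof.
move=> uK; apply: norm_cvg0.
apply: (@squeeze_cvgr _ _ _ _ (fun=> 0) (geometric K 2^-1)).
- by apply: nearW => n /=; rewrite normr_ge0 uK.
- exact: cvg_cst.
- by apply: cvg_geometric; rewrite ger0_norm//; lra.
Qed.

Lemma exp_half_parallelogram (a b : R) :
  expR (- a) + expR (- b) =
  2 * expR (- ((a + b) / 2)) + (expR (- a / 2) - expR (- b / 2)) ^+ 2.
Proof.
have e1 : expR (- a) = expR (- a / 2) ^+ 2.
  by rewrite expr2 -expRD; congr expR; lra.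
have e2 : expR (- b) = expR (- b / 2) ^+ 2.
  by rewrite expr2 -expRD; congr expR; lra.
have -> : expR (- ((a + b) / 2)) = expR (- a / 2) * expR (- b / 2).
  by rewrite -expRD; congr expR; lra.
by rewrite e1 e2; ring.
Qed.

End exp_convergence.

Definition nonneg_measurable_tuple d (X : measurableType d) (R : realType) (n : nat)
    (g : 'I_n -> X -> R) :=
  (forall j, measurable_fun setT (g j)) /\ (forall j x, 0 <= g j x).

Section exp_energy.
Context d (X : measurableType d) (R : realType) (n : nat).
Variable m : {measure set X -> \bar R}.
Hypothesis m_fin : (m setT < +oo)%E.
Implicit Types g h : 'I_n -> X -> R.
Local Notation admissible := (@nonneg_measurable_tuple _ X R n).

Let midpoint g h : 'I_n -> X -> R := fun j x => (g j x + h j x) / 2.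

Definition exp_energy g : \bar R := \int[m]_x (\sum_j expR (- g j x))%:E.

(** The defect of midpoint convexity of [exp_energy]: see [exp_energy_midpoint]. *)
Definition exp_gap g h : \bar R :=
  \int[m]_x (\sum_j (expR (- g j x / 2) - expR (- h j x / 2)) ^+ 2)%:E.

Let measurable_expRN (g : X -> R) : measurable_fun setT g ->
  measurable_fun setT (fun x => expR (- g x)).
Proof.
move=> mg; apply: measurableT_comp => //; exact: measurable_funN.
Qed.

Let measurable_expRN2 (g : X -> R) : measurable_fun setT g ->
  measurable_fun setT (fun x => expR (- g x / 2)).
Proof.
move=> mg; apply: measurableT_comp => //; apply: measurable_funM => //.
exact: measurable_funN.
Qed.

Lemma exp_energy_ge0 g : (0 <= exp_energy g)%E.
Proof.
by apply: integral_ge0 => x _; rewrite lee_fin sumr_ge0// => j _; exact: expR_ge0.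
Qed.

Lemma exp_energy_fin g : admissible g -> exp_energy g \is a fin_num.
Proof.
move=> [mg g0]; rewrite ge0_fin_numE ?exp_energy_ge0//.
apply: (@le_lt_trans _ _ (\int[m]_x (cst n%:R%:E x))%E); last first.
  by rewrite integral_cst// lte_mul_pinfty.
apply: ge0_le_integral => //.
- by move=> x _; rewrite lee_fin sumr_ge0// => j _; exact: expR_ge0.
- apply/measurable_EFinP; apply: measurable_sum => j; exact: measurable_expRN.
- move=> x _; rewrite lee_fin /=.
  rewrite (_ : n%:R = \sum_(j < n) 1); last by rewrite sumr_const card_ord.
  by apply: ler_sum => j _; rewrite -expR0 ler_expR oppr_le0.
Qed.

Lemma exp_energy_midpoint g h : admissible g -> admissible h ->
  (exp_energy g + exp_energy h =
   2%:E * exp_energy (midpoint g h) + exp_gap g h)%E.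
Proof.
move=> [mg g0] [mh h0].
rewrite /exp_energy /exp_gap -ge0_integralD//; last 4 first.
- by move=> x _; rewrite lee_fin sumr_ge0// => j _; exact: expR_ge0.
- apply/measurable_EFinP; apply: measurable_sum => j; exact: measurable_expRN.
- by move=> x _; rewrite lee_fin sumr_ge0// => j _; exact: expR_ge0.
- apply/measurable_EFinP; apply: measurable_sum => j; exact: measurable_expRN.
rewrite -ge0_integralZl_EFin//; last 2 first.
- by move=> x _; rewrite lee_fin sumr_ge0// => j _; exact: expR_ge0.
- apply/measurable_EFinP; apply: measurable_sum => j; apply: measurable_expRN.
  by apply: measurable_funM => //; exact: measurable_funD.
rewrite -ge0_integralD//; last 4 first.
- move=> x _; rewrite -EFinM lee_fin mulr_ge0// sumr_ge0// => j _; exact: expR_ge0.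
- apply/measurable_EFinP; apply: measurable_funM => //.
  apply: measurable_sum => j; apply: measurable_expRN.
  by apply: measurable_funM => //; exact: measurable_funD.
- by move=> x _; rewrite lee_fin sumr_ge0// => j _; exact: sqr_ge0.
- apply/measurable_EFinP; apply: measurable_sum => j; apply: measurable_funX.
  by apply: measurable_funB; exact: measurable_expRN2.
apply: eq_integral => x _; rewrite -EFinM -!EFinD mulr_sumr -!big_split /=.
by congr EFin; apply: eq_bigr => j _; exact: exp_half_parallelogram.
Qed.

Lemma exp_gap_component g h j : admissible g -> admissible h ->
  (\int[m]_x ((expR (- g j x / 2) - expR (- h j x / 2)) ^+ 2)%:E <= exp_gap g h)%E.
Proof.
move=> [mg g0] [mh h0]; apply: ge0_le_integral => //.
- by move=> x _; rewrite lee_fin sqr_ge0.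
- apply/measurable_EFinP; apply: measurable_funX.
  by apply: measurable_funB; exact: measurable_expRN2.
- apply/measurable_EFinP; apply: measurable_sum => i; apply: measurable_funX.
  by apply: measurable_funB; exact: measurable_expRN2.
- move=> x _; rewrite lee_fin (bigD1 j)//= lerDl sumr_ge0// => i _; exact: sqr_ge0.
Qed.

End exp_energy.

Section convex_compactness.
Context d (X : measurableType d) (R : realType) (n : nat).
Variable mu : {sigma_finite_measure set X -> \bar R}.
Local Notation admissible := (@nonneg_measurable_tuple _ X R n).

Variables (I : Type) (C : I -> set ('I_n -> X -> R)).
Hypothesis C_midpoint : forall a g h, C a g -> C a h ->
  C a (fun j x => (g j x + h j x) / 2).
Let meets (s : seq I) (g : 'I_n -> X -> R) :=
  admissible g /\ all (fun a => `[< C a g >]) s.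
Hypothesis C_finite_intersection : forall s : seq I, exists g, meets s g.

Let meets_midpoint s g h : meets s g -> meets s h ->
  meets s (fun j x => (g j x + h j x) / 2).
Proof.
move=> [[mg g0] sg] [[mh h0] sh]; split; first split.
- by move=> j; apply: measurable_funM => //; exact: measurable_funD.
- by move=> j x; rewrite divr_ge0// addr_ge0.
- elim: s sg sh => //= a s IH /andP[/asboolP ag sg] /andP[/asboolP ah sh].
  by rewrite IH// andbT; apply/asboolP; exact: C_midpoint.
Qed.

Section fix_measure.
Variable m : {measure set X -> \bar R}.
Hypothesis m_fin : (m setT < +oo)%E.

Let V (g : 'I_n -> X -> R) : R := fine (exp_energy m g).

Let V_fin g : admissible g -> exp_energy m g = (V g)%:E.
Proof. by move=> ag; rewrite /V fineK// exp_energy_fin. Qed.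

Let V_ge0 g : 0 <= V g. Proof. exact/fine_ge0/exp_energy_ge0. Qed.

Let V_bounded : exists W, forall g, admissible g -> V g <= W.
Proof.
exists (V (fun _ _ => 0)) => g ag; have a0 : admissible (fun _ _ => 0 : R) by split.
rewrite -lee_fin -!V_fin//; have [mg g0] := ag; apply: ge0_le_integral => //.
- by move=> x _; rewrite lee_fin sumr_ge0// => j _; exact: expR_ge0.
- apply/measurable_EFinP; apply: measurable_sum => j; apply: measurableT_comp => //.
  exact: measurable_funN.
- by move=> x _; rewrite lee_fin; apply: ler_sum => j _; rewrite ler_expR oppr0 oppr_le0.
Qed.

Let value (s : seq I) : R := inf [set V g | g in meets s].

Let value_inf s : has_inf [set V g | g in meets s].
Proof.
split; first by have [g sg] := C_finite_intersection s; exists (V g), g.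
by exists 0 => _ [g _ <-].
Qed.

(* v is the supremum over finite families of the infimum of the energy under
   their constraints *)
Let game_value : exists v : R,
  (forall e, 0 < e -> forall s, exists2 g, meets s g & V g <= v + e) /\
  (forall e, 0 < e -> exists s, forall g, meets s g -> v - e <= V g).
Proof.
have [W VW] := V_bounded.
have hs : has_sup (range value).
  split; first by exists (value [::]), [::].
  exists W => _ [s _ <-]; have [g sg] := C_finite_intersection s.
  apply: le_trans (VW g sg.1); apply: ge_inf; last by exists g.
  exact: (value_inf s).2.
exists (sup (range value)); split => e e0 => [s|].
  have [_ [g sg <-] Vg] := inf_adherent e0 (value_inf s).
  exists g => //; rewrite (le_trans (ltW Vg))// lerD2r.
  by apply: ub_le_sup; [exact: hs.2|exists s].
have [_ [s _ <-] sv] := sup_adherent e0 hs.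
exists s => g sg; apply: (le_trans (ltW sv)).
by apply: ge_inf; [exact: (value_inf s).2|exists g].
Qed.

(* two near-minimisers under the same constraints are close, as their midpoint
   also satisfies these constraints and so cannot have much smaller energy *)
Let gap_small v e s : (forall g, meets s g -> v - e <= V g) ->
  forall g h, meets s g -> meets s h -> V g <= v + e -> V h <= v + e ->
  (exp_gap m g h <= (4 * e)%:E)%E.
Proof.
move=> sv g h sg sh Vg Vh; have sgh := meets_midpoint sg sh.
have := exp_energy_midpoint m sg.1 sh.1.
rewrite !V_fin//; [|exact: sgh.1|exact: sh.1|exact: sg.1].
have := sv _ sgh; set w := V _ => vw.
rewrite -EFinM -EFinD; case: (exp_gap m g h) => [r||]// [].
by rewrite lee_fin => E; lra.
Qed.

(** Choose finite families s_k whose constraints force the energy above v - e_k,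
    with e_k geometrically small, and minimise up to e_k under the constraints
    B_k = s_0, ..., s_k. Consecutive near-minimisers g_k and g_(k+1) both meet s_k,
    so exp (- g_k / 2) is a Cauchy sequence almost everywhere. For any further
    index [a], near-minimisers h_k under B_k together with [a] have the same energy
    up to e_k, because v is the supremum over all families; so h_k and g_k are
    close and have the same limit. The limit therefore does not depend on [a],
    although [I] need not be countable. *)
Lemma convex_fip_ae_limit_finite : exists gamma : 'I_n -> X -> \bar R,
  [/\ forall j, measurable_fun setT (gamma j),
      forall j x, (0 <= gamma j x)%E &
      forall a, exists h : nat -> 'I_n -> X -> R,
        (forall k, C a (h k) /\ admissible (h k)) /\
        {ae m, forall x, forall j, (h k j x)%:E @[k --> \oo] --> gamma j x}].
Proof.
have [v [vle vge]] := game_value.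
pose e k : R := 4^-1 * 8^-1 ^+ k.
have e0 k : 0 < e k by rewrite mulr_gt0 ?exprn_gt0 ?invr_gt0.
have [s sP] := choice (fun k => vge (e k) (e0 k)).
pose B := fix B k := s k ++ if k is k'.+1 then B k' else [::].
have BS k i g : (i <= k)%N -> meets (B k) g -> meets (s i) g.
  elim: k => [|k IH] ik [ag /=]; rewrite all_cat => /andP[sg Bg].
    by move: ik; rewrite leqn0 => /eqP ->.
  by move: ik; rewrite leq_eqVlt => /predU1P[->//|ik]; exact: IH.
have [g gP] := choice (fun k => ltac:(
  have [g Bg Vg] := vle (e k) (e0 k) (B k); exact: (ex_intro _ g (conj Bg Vg)))).
pose half (h : 'I_n -> X -> R) j x := expR (- h j x / 2).
have gap_ae (h1 h2 : nat -> 'I_n -> X -> R) :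
    (forall k, meets (s k) (h1 k)) -> (forall k, meets (s k) (h2 k)) ->
    (forall k, V (h1 k) <= v + e k) -> (forall k, V (h2 k) <= v + e k) ->
    {ae m, forall x j, exists K, forall k,
        `|half (h1 k) j x - half (h2 k) j x| <= K * 2^-1 ^+ k}.
  move=> sh1 sh2 Vh1 Vh2; apply: filter_forall => j.
  apply: (@ae_geometric_decay _ _ _ m (fun k x => half (h1 k) j x - half (h2 k) j x)).
    move=> k; have [[mh1 _] _] := sh1 k; have [[mh2 _] _] := sh2 k.
    by apply: measurable_funB; apply: measurableT_comp => //;
      apply: measurable_funM => //; exact: measurable_funN.
  move=> k; apply: (le_trans (exp_gap_component m j (sh1 k).1 (sh2 k).1)).
  apply: (le_trans (gap_small (sP k) (sh1 k) (sh2 k) (Vh1 k) (Vh2 k))).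
  by rewrite lee_fin /e mulrA divff// mul1r.
have gs k : meets (s k) (g k) by exact: (BS k k _ (leqnn k) (gP k).1).
have gs1 k : meets (s k) (g k.+1) by exact: (BS k.+1 k _ (leqnSn k) (gP k.+1).1).
have ae_g := gap_ae _ (fun k => g k.+1) gs gs1 (fun k => (gP k).2) _.
have {ae_g} ae_g : {ae m, forall x j, cvgn (fun k => half (g k) j x)}.
  have : {ae m, forall x j, exists K, forall k,
        `|half (g k) j x - half (g k.+1) j x| <= K * 2^-1 ^+ k}.
    apply: ae_g => k; apply: (le_trans (gP k.+1).2); rewrite lerD2l.
    by rewrite /e exprS ler_wpM2l// ler_piMl ?exprn_ge0//; lra.
  by apply: filterS => x H j; have [K] := H j; exact: geometric_decay_cvg.
exists (fun j x => limn_esup (fun k => (g k j x)%:E)); split => [j|j x|a].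
- apply: measurable_fun_limn_esup => k; apply/measurable_EFinP.
  exact: (gs k).1.1.
- apply: (@le_trans _ _ (limn_einf (fun k => (g k j x)%:E))); last exact: limn_einf_sup.
  rewrite limn_einf_lim; apply: lime_ge; first exact: is_cvg_einfs.
  apply: nearW => k; apply: le_ereal_inf_tmp => _ [i _ <-].
  by rewrite lee_fin (gs i).1.2.
have [h hP] := choice (fun k => ltac:(
  have [h Bh Vh] := vle (e k) (e0 k) (a :: B k); exact: (ex_intro _ h (conj Bh Vh)))).
have hB k : meets (B k) (h k) /\ C a (h k).
  by have [[ah /= /andP[/asboolP Ca Bh]] _] := hP k.
exists h; split => [k|]; first by split; [exact: (hB k).2|exact: (hB k).1.1].
have ae_h := gap_ae g h gs (fun k => BS k k _ (leqnn k) (hB k).1)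
  (fun k => (gP k).2) (fun k => (hP k).2).
apply: filterS2 ae_g ae_h => x gx hx j.
have [K hK] := hx j; have gl := gx j.
have hl : half (h k) j x @[k --> \oo] --> limn (fun k => half (g k) j x).
  rewrite (_ : (fun _ => _) = (fun k => half (g k) j x -
    (half (g k) j x - half (h k) j x))); last by apply/funext => k; ring.
  rewrite -[X in _ --> X]subr0; apply: cvgB => //.
  exact: geometric_decay_cvg0 hK.
have g' := cvg_exp_half_neg2ln gl; have h' := cvg_exp_half_neg2ln hl.
rewrite is_cvg_limn_esupE; last first.
  by apply/cvg_ex; exists (neg2ln (limn (fun k => half (g k) j x))).
by rewrite (cvg_lim _ g').
Qed.
End fix_measure.

(** A finite intersection property for midpoint-convex sets of tuples of nonnegative
    measurable functions: the sets have a common limit almost everywhere, reached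
    from inside each of them. The limit may take the value +oo. *)
Lemma convex_fip_ae_limit : exists gamma : 'I_n -> X -> \bar R,
  [/\ forall j, measurable_fun setT (gamma j),
      forall j x, (0 <= gamma j x)%E &
      forall a, exists h : nat -> 'I_n -> X -> R,
        (forall k, C a (h k) /\ admissible (h k)) /\
        {ae mu, forall x, forall j, (h k j x)%:E @[k --> \oo] --> gamma j x}].
Proof.
have [m [mfin mmu]] := sigma_finite_equiv_finite mu.
have [gamma [mg g0 gP]] := convex_fip_ae_limit_finite mfin.
exists gamma; split => // a; have [h [Ch hg]] := gP a.
by exists h; split => //; exact: ae_transfer mmu hg.
Qed.

End convex_compactness.

(** * Limits of geometric means, scaling, and joint saturation *)

Lemma cvg_powR_nneg (R : realType) (u : nat -> R) (l a : R) : 0 < a ->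
  (forall k, 0 <= u k) -> u @ \oo --> l -> u k `^ a @[k --> \oo] --> l `^ a.
Proof.
move=> a0 u0 ul; have : 0 <= l by apply: (cvgr_to_ge ul); exact: nearW.
rewrite le_eqVlt => /predU1P[l0|l0]; last first.
  have : derivable (@powR R ^~ a) l 1.
    by apply: derivable_powR; rewrite in_itv /= l0.
  move=> /derivable1_diffP/differentiable_continuous cont.
  exact: (cvg_comp _ _ ul cont).
rewrite -l0 in ul *; rewrite powR0 ?gt_eqF//; apply/cvgrPdist_lt => e e0.
have e0' : 0 < e `^ a^-1 by rewrite powR_gt0.
move/cvgrPdist_lt : ul => /(_ _ e0'); apply: filterS => k /=.
rewrite !sub0r !normrN (ger0_norm (u0 k)) (ger0_norm (powR_ge0 _ _)) => uk.
rewrite -[e]powRr1 ?(ltW e0)// -(mulVf (lt0r_neq0 a0)) powRrM.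
by apply: gt0_ltr_powR; rewrite ?nnegrE ?powR_ge0.
Qed.

Lemma le_geomean_cvg (R : realType) n (alpha : 'I_n -> R) (u : nat -> 'I_n -> R) l c :
  (forall j, 0 < alpha j) -> (forall k j, 0 <= u k j) ->
  (forall j, u k j @[k --> \oo] --> l j) ->
  (forall k, c <= geomean alpha (u k)) -> c <= geomean alpha l.
Proof.
move=> a0 u0 ul cu.
have gl : geomean alpha (u k) @[k --> \oo] --> geomean alpha l.
  rewrite /geomean; elim: (index_enum _) => [|j s IH].
    by under eq_fun do rewrite big_nil; rewrite big_nil; exact: cvg_cst.
  under eq_fun do rewrite big_cons; rewrite big_cons; apply: cvgM => //.
  exact: cvg_powR_nneg.
by apply: (cvgr_to_ge gl); exact: nearW.
Qed.

Lemma Lnorm_null d (X : measurableType d) (R : realType)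
    (mu : {measure set X -> \bar R}) (p : \bar R) (f : X -> \bar R) :
  measurable_fun setT f -> (1 <= p)%E -> mu setT = 0%E -> Lnorm mu p f = 0%E.
Proof.
move=> mf p1 mu0; rewrite unlock /Lnorm; case: p p1 => [p||]//= p1; last first.
  by rewrite mu0 ltxx.
have p0 : 0 < p by rewrite (lt_le_trans ltr01)// -lee_fin.
rewrite null_set_integral ?poweR0r ?invr_neq0 ?gt_eqF//.
apply: (measurableT_comp (measurable_poweR _)) => //.
exact: measurableT_comp.
Qed.

Section operators.
Context {R : realType} {k : scalars}.
Context dX (X : measurableType dX) (mu : {measure set X -> \bar R}).
Context dY (Y : measurableType dY) (nu : {measure set Y -> \bar R}) (r : R).
Hypothesis r_ge1 : 1 <= r.
Variable T : (Y -> scalar_field R k) -> (X -> scalar_field R k).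
Local Notation S := (simple_functions nu r%:E).
Hypothesis linT : linear_operator mu S T.

Let r_gt0 : 0 < r. Proof. exact: lt_le_trans r_ge1. Qed.

Lemma simple_functionsZ c (f : Y -> scalar_field R k) :
  S f -> S (fun y => scalar_of_real c * f y).
Proof.
move=> Sf; have := simple_functions_lin r_gt0 c Sf (simple_functions0 nu r_gt0).
by under [X in S X -> _]eq_fun do rewrite addr0.
Qed.

Lemma linear_operatorZ c (f : Y -> scalar_field R k) : S f ->
  {ae mu, forall x, T (fun y => scalar_of_real c * f y) x = scalar_of_real c * T f x}.
Proof.
move=> Sf; have := linear_operator_sum r_gt0 linT (fun _ : 'I_1 => c) (fun _ => Sf).
under [X in T X]eq_fun do rewrite big_ord1.
by apply: filterS => x; rewrite big_ord1.
Qed.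

Lemma integral_modulus_powRZ c (f : Y -> scalar_field R k) : 0 <= c -> S f ->
  (\int[nu]_y (modulus (scalar_of_real c * f y) `^ r)%:E =
   (c `^ r)%:E * \int[nu]_y (modulus (f y) `^ r)%:E)%E.
Proof.
move=> c0 [mf _ _]; rewrite -ge0_integralZl_EFin ?powR_ge0//; last 2 first.
- by move=> y _; rewrite lee_fin powR_ge0.
- exact: measurable_modulus_powR.
by apply: eq_integral => y _; rewrite modulusM powRM ?modulus_ge0// ger0_norm// EFinM.
Qed.

Lemma simple_functions_normalize (f : Y -> scalar_field R k) : S f -> exists2 c, 0 < c &
  (\int[nu]_y (modulus (scalar_of_real c * f y) `^ r)%:E <= 1)%E.
Proof.
move=> Sf; have [_ _ /(lpnorm_lty _ r_gt0) nf] := Sf.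
set I := (\int[nu]_y (modulus (f y) `^ r)%:E)%E in nf.
have I0 : (0 <= I)%E by apply: integral_ge0 => y _; rewrite lee_fin powR_ge0.
have IE : I = (fine I)%:E by rewrite fineK// ge0_fin_numE.
have i0 : 0 <= fine I by exact: fine_ge0.
pose c := (1 + fine I)^-1; have c0 : 0 < c by rewrite invr_gt0 ltr_pwDl.
exists c => //; rewrite integral_modulus_powRZ ?(ltW c0)// -/I IE -EFinM lee_fin.
apply: (@le_trans _ _ (c * fine I)).
  rewrite ler_wpM2r// ge1r_powR// c0 /c invf_le1 ?ltr_pwDl// lerDl//.
by rewrite mulrC ler_pdivrMr ?ltr_pwDl// mul1r lerDr.
Qed.

End operators.

Section joint_saturation.
Context {R : realType} {k : scalars} {n : nat}.
Variable r : 'I_n -> R.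
Hypothesis r_ge1 : forall j, 1 <= r j.
Context dX (X : measurableType dX) (mu : {measure set X -> \bar R}).
Context (dY : 'I_n -> measure_display) (Y : forall j, measurableType (dY j)).
Variable nu : forall j, {measure set (Y j) -> \bar R}.
Variable T : forall j, (Y j -> scalar_field R k) -> (X -> scalar_field R k).
Arguments T : clear implicits.
Local Notation S j := (simple_functions (nu j) (r j)%:E).
Hypothesis linT : forall j, linear_operator mu (S j) (T j).
Hypothesis satT : forall j, saturates mu (S j) (T j).

Definition unit_ball_tuple (a : forall j, Y j -> scalar_field R k) :=
  forall j, S j (a j) /\ (\int[nu j]_y (modulus (a j y) `^ r j)%:E <= 1)%E.

(** Shrink the set once for each operator, then normalise the functions found. *)
Lemma joint_saturation (E : set X) : measurable E -> (0 < mu E)%E ->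
  exists E' a, [/\ measurable E', E' `<=` E, (0 < mu E')%E, unit_ball_tuple a &
    {ae mu, forall x, E' x -> forall j, 0 < modulus (T j (a j) x)}].
Proof.
move=> mE E0.
have chain m : exists E', [/\ measurable E', E' `<=` E, (0 < mu E')%E &
    forall j : 'I_n, (j < m)%N -> exists2 h, S j h &
      {ae mu, forall x, E' x -> 0 < modulus (T j h x)}].
  elim: m => [|m [E1 [mE1 sE1 E10 hE1]]]; first by exists E; split.
  have [mn|nm] := ltnP m n; last first.
    exists E1; split => // j jm; apply: hE1.
    by rewrite (leq_trans (ltn_ord j)).
  have [E2 [mE2 sE2 E20 [h Sh hE2]]] := @satT (Ordinal mn) E1 mE1 E10.
  exists E2; split => // [|j]; first exact: subset_trans sE1.
  rewrite ltnS leq_eqVlt => /predU1P[jm|jm].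
    by have -> : j = Ordinal mn by [exact/val_inj]; exists h.
  have [h' Sh' hE'] := hE1 j jm; exists h' => //.
  by apply: filterS hE' => x H /sE2.
have [E' [mE' sE' E'0 hE']] := chain n.
have hP j : exists a : Y j -> scalar_field R k,
    [/\ S j a, (\int[nu j]_y (modulus (a y) `^ r j)%:E <= 1)%E &
    {ae mu, forall x, E' x -> 0 < modulus (T j a x)}].
  have [h Sh hx] := hE' j (ltn_ord j).
  have [c c0 hc] := simple_functions_normalize (r_ge1 j) Sh.
  exists (fun y => scalar_of_real c * h y); split => //.
    exact: (simple_functionsZ (r_ge1 j)).
  have := linear_operatorZ (r_ge1 j) (linT j) c Sh.
  by apply: filterS2 hx => x hx -> /hx; rewrite modulusM ger0_norm ?(ltW c0)//; exact: mulr_gt0.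
exists E', (fun j => projT1 (cid (hP j))); split => //.
  by move=> j; case: cid => /= a [].
have : {ae mu, forall x j, E' x -> 0 < modulus (T j (projT1 (cid (hP j))) x)}.
  by apply: filter_forall => j; case: cid => /= a [].
by apply: filterS => x H E'x j; exact: H.
Qed.

End joint_saturation.

(** * The factorizing weights *)

Section fatou_ae.
Context d (X : measurableType d) (R : realType) (mu : {measure set X -> \bar R}).

Lemma gt0_measure_not_ae_empty (E : set X) : measurable E -> (0 < mu E)%E ->
  ~ {ae mu, forall x, ~ E x}.
Proof.
move=> mE E0 [N [mN N0 sN]]; suff : (mu E <= 0)%E by rewrite leNgt E0.
by rewrite -N0 le_measure ?inE// => x Ex; apply: sN => /(_ Ex).
Qed.

(** Fatou's lemma for a sequence that converges almost everywhere. *)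
Lemma integral_ae_cvg_le (f : nat -> X -> R) (l : X -> \bar R) (c : \bar R) :
  (forall n, measurable_fun setT (f n)) -> (forall n x, 0 <= f n x) ->
  measurable_fun setT l -> (forall x, (0 <= l x)%E) ->
  {ae mu, forall x, (f n x)%:E @[n --> \oo] --> l x} ->
  (forall n, \int[mu]_x (f n x)%:E <= c)%E -> (\int[mu]_x l x <= c)%E.
Proof.
move=> mf f0 ml l0 fl fc; pose F n x := (f n x)%:E.
have mF n : measurable_fun setT (F n) by exact/measurable_EFinP.
have F0 n x : (0 <= F n x)%E by rewrite lee_fin.
have m_einf : measurable_fun setT (fun x => limn_einf (F ^~ x)).
  rewrite (_ : (fun _ => _) = fun x => (- limn_esup (fun n => - F n x))%E).
    apply: measurableT_comp => //; apply: measurable_fun_limn_esup => n.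
    exact: measurableT_comp.
  apply/funext => x; have := limn_esupN (F ^~ x); rewrite /comp => ->.
  by rewrite oppeK.
have einf0 x : (0 <= limn_einf (F ^~ x))%E.
  rewrite limn_einf_lim; apply: lime_ge; first exact: is_cvg_einfs.
  by apply: nearW => n; apply: le_ereal_inf_tmp => _ [i _ <-].
rewrite (ge0_ae_eq_integral (g := fun x => limn_einf (F ^~ x))) => //; last first.
  apply: filterS fl => x Fl _; rewrite is_cvg_limn_einfE; last by apply/cvg_ex; exists (l x).
  exact/esym/cvg_lim.
apply: le_trans (fatou mu measurableT mF (fun n x _ => F0 n x)) _.
rewrite limn_einf_lim; apply: lime_le; first exact: is_cvg_einfs.
apply: nearW => n; apply: le_trans (fc n); apply: ereal_inf_lbound.
by exists n => /=.
Qed.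

End fatou_ae.

Section factorization.
Context {R : realType} {k : scalars} {n : nat}.
Variables (alpha : 'I_n -> R) (q : \bar R) (r : 'I_n -> R).
Hypothesis alpha_gt0 : forall j, 0 < alpha j.
Hypothesis alpha_sum1 : \sum_(j < n) alpha j = 1.
Hypothesis q_ge2 : (2%:E <= q)%E.
Hypothesis r_ge2 : forall j, 2 <= r j.
Context dX (X : measurableType dX) (mu : {sigma_finite_measure set X -> \bar R}).
Context (dY : 'I_n -> measure_display) (Y : forall j, measurableType (dY j)).
Variable nu : forall j, {measure set (Y j) -> \bar R}.
Variable T : forall j, (Y j -> scalar_field R k) -> (X -> scalar_field R k).
Arguments T : clear implicits.
Local Notation S j := (simple_functions (nu j) (r j)%:E).
Hypothesis linT : forall j, linear_operator mu (S j) (T j).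
Hypothesis satT : forall j, saturates mu (S j) (T j).
Variable B : R.
Hypothesis multilinear_bound : forall f : forall j, Y j -> scalar_field R k,
  (forall j, S j (f j)) ->
  (Lnorm mu q (fun x => (\prod_(j < n) modulus (T j (f j) x) `^ alpha j)%:E)
   <= B%:E * \prod_(j < n) (lpnorm (nu j) (r j)%:E (f j) `^ alpha j))%E.

Let r_ge1 j : 1 <= r j. Proof. by have := r_ge2 j; lra. Qed.

Let r_gt0 j : 0 < r j. Proof. by have := r_ge2 j; lra. Qed.

Let measurable_T j f : S j f -> measurable_fun setT (fun x => modulus (T j f x)).
Proof. by move=> Sf; apply: measurable_modulus; exact: (linT j).1. Qed.

(** Otherwise the product of the T_j f_j would vanish almost everywhere for every f,
    against joint saturation. So a nontrivial X forces B > 0. *)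
Lemma multilinear_const_gt0 : (0 < mu setT)%E -> 0 < B.
Proof.
move=> mu0; rewrite ltNge; apply/negP => B0.
have [E [a [mE _ E0 ua aE]]] := joint_saturation r_ge1 linT satT measurableT mu0.
have q0 : (0 < q)%E by apply: lt_le_trans q_ge2.
have := multilinear_bound (fun j => (ua j).1).
set Q := (fun x => _); set P := (\prod_(_ < _) _)%E.
have P0 : (0 <= P)%E.
  rewrite /P; elim/big_ind: _ => // [x y|j _]; [exact: mule_ge0|exact: poweR_ge0].
have BP : (B%:E * P <= 0)%E by rewrite mule_le0_ge0.
move=> /le_trans/(_ BP) => QB.
have {QB} : (Lnorm mu q Q = 0)%E by apply/eqP; rewrite eq_le QB Lnorm_ge0.
have mQ : measurable_fun setT Q.
  apply/measurable_EFinP.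
  apply: (@measurable_geomean _ _ _ _ alpha (fun j x => modulus (T j (a j) x))) => j.
  exact: (measurable_T (ua j).1).
move=> /(Lnorm_eq0_eq0 mQ q0) Q0.
apply: (gt0_measure_not_ae_empty mE E0); apply: filterS2 aE Q0 => x aE Q0 Ex.
have := Q0 I; rewrite /Q => -[] Qx.
have := geomean_gt0 alpha (aE Ex); rewrite /geomean Qx.
by rewrite ltxx.
Qed.

Hypothesis B_gt0 : 0 < B.
Variable G : X -> R.
Hypothesis mG : measurable_fun setT G.
Hypothesis G0 : forall x, 0 <= G x.
Local Notation normG := (Lnorm mu (hoelder_conjugate (q / 2%:E)) (EFin \o G)).
Hypothesis nG : (normG < +oo)%E.
Hypothesis nG_gt0 : (0 < normG)%E.

Let I := {a : forall j, Y j -> scalar_field R k | unit_ball_tuple r nu a}.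
Let F (a : I) j x : R := modulus (T j (sval a j) x) ^+ 2.
Let M : R := duality_const r * B ^+ 2 * fine normG.

Let F_ge0 a j x : 0 <= F a j x. Proof. exact: sqr_ge0. Qed.

Let mF a j : measurable_fun setT (F a j).
Proof. by apply: measurable_funX; apply: measurable_T; case: (svalP a j). Qed.

Lemma duality_const_gt0 : 0 < duality_const r.
Proof.
rewrite mulr_gt0 ?exprn_gt0//; last first.
  by apply: prodr_gt0 => j _; rewrite ltr_pwDl// type2_const_ge0.
by rewrite pmulr_rgt0// pmulr_rgt0//; exact: lt_le_trans ltr01 (khintchine_const_ge1 4).
Qed.

Let M_gt0 : 0 < M.
Proof.
rewrite /M mulr_gt0//; last by rewrite fine_gt0// nG_gt0.
by rewrite mulr_gt0 ?duality_const_gt0 ?exprn_gt0.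
Qed.

(* the constraint attached to a tuple; its second half is imposed only where all
   F a j are positive, which is where finitely many tuples can ensure it *)
Let C (a : I) (g : 'I_n -> X -> R) :=
  [/\ nonneg_measurable_tuple g,
      forall j, ((alpha j)%:E * \int[mu]_x (F a j x * g j x)%:E <= (8 * M)%:E)%E &
      forall x, (forall j, 0 < F a j x) -> G x <= geomean alpha (g ^~ x)].

Let C_midpoint a g h : C a g -> C a h -> C a (fun j x => (g j x + h j x) / 2).
Proof.
move=> [[mg g0] gM gG] [[mh h0] hM hG]; split; first split.
- by move=> j; apply: measurable_funM => //; exact: measurable_funD.
- by move=> j x; rewrite divr_ge0// addr_ge0.
- move=> j; rewrite (eq_integral (fun x => (2^-1)%:E *
    ((F a j x * g j x)%:E + (F a j x * h j x)%:E))%E); last first.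
    by move=> x _; rewrite -EFinD -EFinM; congr EFin; field.
  have mFg : measurable_fun setT (fun x => (F a j x * g j x)%:E).
    by apply/measurable_EFinP; exact: measurable_funM.
  have mFh : measurable_fun setT (fun x => (F a j x * h j x)%:E).
    by apply/measurable_EFinP; exact: measurable_funM.
  have Fg0 x : (0 <= (F a j x * g j x)%:E)%E by rewrite lee_fin mulr_ge0.
  have Fh0 x : (0 <= (F a j x * h j x)%:E)%E by rewrite lee_fin mulr_ge0.
  rewrite ge0_integralZl_EFin//; last 2 first.
  - by move=> x _; rewrite adde_ge0.
  - exact: emeasurable_funD.
  rewrite ge0_integralD// muleCA ge0_muleDr ?integral_ge0//.
  apply: (@le_trans _ _ ((2^-1)%:E * ((8 * M)%:E + (8 * M)%:E))%E).
    by apply: lee_wpmul2l; [rewrite lee_fin|exact: leeD].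
  by rewrite -EFinD -EFinM lee_fin; lra.
- move=> x Fx; apply: geomean_midpoint => //; [exact: gG|exact: hG].
Qed.

Let C_finite_intersection (s : seq I) : exists g,
  nonneg_measurable_tuple g /\ all (fun a => `[< C a g >]) s.
Proof.
case: s => [|a0 s]; first by exists (fun _ _ => 0).
pose a (i : 'I_(size s).+1) := nth a0 (a0 :: s) i.
have le_M (w : 'I_(size s).+1 -> R) : (forall i, 0 <= w i) -> \sum_i w i = 1 ->
    (\int[mu]_x (G x * geomean alpha (fun j => \sum_i w i * F (a i) j x))%:E <= M%:E)%E.
  move=> w0 w1.
  have := square_function_bound alpha_gt0 alpha_sum1 q_ge2 r_ge2 linT (ltW B_gt0)
    multilinear_bound mG G0 nG w0 w1
    (fun i j => (svalP (a i) j).1) (fun i j => (svalP (a i) j).2).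
  by rewrite -[X in (_ * X)%E]fineK// ge0_fin_numE// Lnorm_ge0.
have [g [mg g0 gM gG]] := near_optimizer_weights alpha_gt0 alpha_sum1
  (fun i j => mF (a i) j) (fun i j x => F_ge0 (a i) j x) mG G0 M_gt0 le_M.
exists g; split => //; apply/(all_nthP a0) => i iN; apply/asboolP.
split => // [j|x]; first exact: (gM (Ordinal iN)).
exact: (gG (Ordinal iN)).
Qed.

(** On the set where gamma_j is infinite, joint saturation would give a tuple [a] with
    F a j > 0 on a part of positive measure, where F a j * gamma_j is then not
    integrable. On the set where the geometric mean of [g] is below [G], it would
    give a tuple whose constraint contradicts this on a part of positive measure. *)
Lemma factorizing_weights : exists g : 'I_n -> X -> R,
  [/\ forall j x, 0 <= g j x,
      forall j, measurable_fun setT (g j),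
      {ae mu, forall x, G x <= \prod_(j < n) g j x `^ alpha j} &
      forall a, unit_ball_tuple r nu a -> forall j,
        ((alpha j)%:E * \int[mu]_x (modulus (T j (a j) x) ^+ 2 * g j x)%:E
         <= (8 * M)%:E)%E].
Proof.
have [gamma [mgamma gamma0 gammaP]] :=
  convex_fip_ae_limit mu C_midpoint C_finite_intersection.
have Fgamma a j : (\int[mu]_x ((F a j x)%:E * gamma j x) <= (8 * M / alpha j)%:E)%E.
  have [h [Ch hgamma]] := gammaP a.
  apply: (@integral_ae_cvg_le _ _ _ mu (fun i x => F a j x * h i j x)).
  - by move=> i; apply: measurable_funM => //; exact: (Ch i).2.1.
  - by move=> i x; rewrite mulr_ge0//; exact: (Ch i).2.2.
  - by apply: emeasurable_funM => //; exact/measurable_EFinP.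
  - by move=> x; rewrite mule_ge0// lee_fin.
  - apply: filterS hgamma => x hx.
    by under eq_fun do rewrite EFinM; apply: cvgeZl.
  - move=> i; have [_ /(_ j) + _] := (Ch i).1.
    rewrite [(8 * M / _)%:E](_ : _ = ((alpha j)^-1%:E * (8 * M)%:E)%E); last first.
      by rewrite -EFinM mulrC.
    by rewrite lee_pdivlMl.
have gamma_fin : {ae mu, forall x, forall j, gamma j x \is a fin_num}.
  apply: filter_forall => j; pose E := gamma j @^-1` [set +oo%E].
  have mE : measurable E by rewrite -[E]setTI; exact: (mgamma j measurableT).
  have [E0|E0] := eqVneq (mu E) 0%E.
    exists E; split => // x /=; rewrite ge0_fin_numE// ltNge leye_eq => /negP.
    by rewrite negbK => /eqP.
  have {}E0 : (0 < mu E)%E by rewrite lt0e E0 measure_ge0.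
  have [E' [a [mE' sE' E'0 ua aE']]] := joint_saturation r_ge1 linT satT mE E0.
  have iFg : mu.-integrable setT (fun x => (F (exist _ a ua) j x)%:E * gamma j x)%E.
    apply/integrableP; split.
      by apply: emeasurable_funM => //; exact/measurable_EFinP.
    under eq_integral do rewrite gee0_abs ?mule_ge0 ?lee_fin//.
    exact: le_lt_trans (Fgamma _ _) (ltry _).
  exfalso; apply: (gt0_measure_not_ae_empty mE' E'0).
  apply: filterS2 aE' (integrable_ae measurableT iFg) => x Fx /(_ Logic.I) + E'x.
  have -> : gamma j x = +oo%E by exact: sE'.
  by rewrite gt0_muley// lte_fin exprn_gt0// Fx.
pose g j x := fine (gamma j x).
have g0 j x : 0 <= g j x by exact: fine_ge0.
have mg j : measurable_fun setT (g j) by exact: measurableT_comp.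
have gE : {ae mu, forall x, forall j, gamma j x = (g j x)%:E}.
  by apply: filterS gamma_fin => x gx j; rewrite /g fineK.
exists g; split => //; last first.
  move=> a ua j; pose a' : I := exist _ a ua.
  have -> : (\int[mu]_x (modulus (T j (a j) x) ^+ 2 * g j x)%:E =
      \int[mu]_x ((F a' j x)%:E * gamma j x))%E.
    apply: ge0_ae_eq_integral => //.
    - apply/measurable_EFinP; apply: measurable_funM => //; exact: (mF a').
    - by apply: emeasurable_funM => //; apply/measurable_EFinP; exact: mF.
    - by move=> x _; rewrite lee_fin mulr_ge0// sqr_ge0.
    - by move=> x _; rewrite mule_ge0// lee_fin.
    - by apply: filterS gE => x gx _; rewrite gx -EFinM.
  apply: (le_trans (lee_wpmul2l _ (Fgamma a' j))); first by rewrite lee_fin ltW.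
  by rewrite -EFinM lee_fin mulrC divfK// gt_eqF.
pose E := [set x | geomean alpha (g ^~ x) < G x].
have mE : measurable E.
  rewrite -[E]setTI; apply: measurable_fun_ltr => //; exact: measurable_geomean.
have [E0|E0] := eqVneq (mu E) 0%E.
  exists E; split => // x /= /negP; by rewrite -ltNge.
have {}E0 : (0 < mu E)%E by rewrite lt0e E0 measure_ge0.
have [E' [a [mE' sE' E'0 ua aE']]] := joint_saturation r_ge1 linT satT mE E0.
have [h [Ch hgamma]] := gammaP (exist _ a ua).
exfalso; apply: (gt0_measure_not_ae_empty mE' E'0).
apply: filterS3 aE' gE hgamma => x Fx gx hx E'x.
have : geomean alpha (g ^~ x) < G x by exact: sE'.
rewrite ltNge => /negP; apply.
apply: (@le_geomean_cvg _ _ _ (fun i j => h i j x)) => //.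
- by move=> i j; exact: (Ch i).2.2.
- by move=> j; have := hx j; rewrite gx => /fine_cvgP[].
- move=> i; have [_ _] := (Ch i).1; apply => j.
  by rewrite /F exprn_gt0// Fx.
Qed.

End factorization.

(** * The theorem *)

(** Normalising f fails when its norm is 0, so f is multiplied by 1 / (||f|| + e) with
    e > 0 arbitrary instead. *)
Lemma weighted_bound_homogeneous (R : realType) (k : scalars)
    dX (X : measurableType dX) (mu : {measure set X -> \bar R})
    dY (Y : measurableType dY) (nu : {measure set Y -> \bar R}) (r : R)
    (T : (Y -> scalar_field R k) -> (X -> scalar_field R k)) (g : X -> R) (K : R) :
  1 <= r -> linear_operator mu (simple_functions nu r%:E) T ->
  (forall x, 0 <= g x) -> measurable_fun setT g -> 0 < K ->
  (forall f, simple_functions nu r%:E f ->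
     (\int[nu]_y (modulus (f y) `^ r)%:E <= 1)%E ->
     (\int[mu]_x (modulus (T f x) ^+ 2 * g x)%:E <= K%:E)%E) ->
  forall f, simple_functions nu r%:E f ->
  ((\int[mu]_x (modulus (T f x) ^+ 2 * g x)%:E) `^ 2^-1
     <= (Num.sqrt K)%:E * lpnorm nu r%:E f)%E.
Proof.
move=> r1 linT g0 mg K0 unitK f Sf; have r0 : 0 < r by exact: lt_le_trans r1.
set J := (\int[mu]_x _)%E; have J0 : (0 <= J)%E.
  by apply: integral_ge0 => x _; rewrite lee_fin mulr_ge0// sqr_ge0.
have [_ _ nf] := Sf; set L := lpnorm nu r%:E f in nf *.
have LE : L = (fine L)%:E by rewrite fineK// ge0_fin_numE// Lnorm_ge0.
have L0 : 0 <= fine L by apply: fine_ge0; exact: Lnorm_ge0.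
have scaled c : 0 < c -> c * fine L <= 1 -> ((c ^+ 2)%:E * J <= K%:E)%E.
  move=> c0 cL.
  have Scf := simple_functionsZ r1 c Sf.
  have : (\int[nu]_y (modulus (scalar_of_real c * f y) `^ r)%:E <= 1)%E.
    rewrite (integral_modulus_powRZ (ltW c0) Sf) -lpnorm_powR// -/L LE.
    rewrite poweR_EFin -EFinM -powRM ?(ltW c0)// lee_fin.
    rewrite [leRHS](_ : _ = 1 `^ r); last by rewrite powR1.
    by apply: ge0_ler_powR; rewrite ?nnegrE ?mulr_ge0// ltW.
  move/(unitK _ Scf); apply: le_trans.
  have mTf : measurable_fun setT (fun x => (modulus (T f x) ^+ 2 * g x)%:E).
    apply/measurable_EFinP; apply: measurable_funM => //; apply: measurable_funX.
    by apply: measurable_modulus; exact: linT.1.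
  rewrite -ge0_integralZl_EFin ?sqr_ge0//; last first.
    by move=> x _; rewrite lee_fin mulr_ge0// sqr_ge0.
  rewrite le_eqVlt; apply/orP; left; apply/eqP; apply: ge0_ae_eq_integral => //.
  - exact: measurable_funeM.
  - apply/measurable_EFinP; apply: measurable_funM => //; apply: measurable_funX.
    by apply: measurable_modulus; exact: linT.1.
  - by move=> x _; rewrite -EFinM lee_fin mulr_ge0 ?sqr_ge0// mulr_ge0 ?sqr_ge0.
  - by move=> x _; rewrite lee_fin mulr_ge0 ?sqr_ge0.
  - have := linear_operatorZ r1 linT c Sf; apply: filterS => x /= Tx _.
    by rewrite Tx modulusM -EFinM exprMn real_normK ?num_real// mulrA.
have JE : J = (fine J)%:E.
  rewrite fineK// ge0_fin_numE// ltey; apply/negP => /eqP Jy.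
  have c0 : 0 < (1 + fine L)^-1 by rewrite invr_gt0 ltr_pwDl.
  have cL : (1 + fine L)^-1 * fine L <= 1.
    by rewrite mulrC ler_pdivrMr ?ltr_pwDl// mul1r lerDr.
  by have := scaled _ c0 cL; rewrite Jy gt0_muley ?lte_fin ?exprn_gt0.
have j0 : 0 <= fine J by exact: fine_ge0.
rewrite JE LE poweR_EFin -EFinM lee_fin powR12_sqrt//.
have sK : 0 < Num.sqrt K by rewrite sqrtr_gt0.
rewrite mulrC -ler_pdivrMr//; apply/ler_addgt0Pr => e e0.
have Le : 0 < fine L + e by rewrite ltr_wpDl.
rewrite ler_pdivrMr// -[fine L + e](ger0_norm (ltW Le)) -sqrtr_sqr -sqrtrM ?sqr_ge0//.
rewrite ler_wsqrtr// -ler_pdivrMl ?exprn_gt0//.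
have c0 : 0 < (fine L + e)^-1 by rewrite invr_gt0.
have cL : (fine L + e)^-1 * fine L <= 1.
  by rewrite mulrC ler_pdivrMr// mul1r lerDl ltW.
have := scaled _ c0 cL; by rewrite JE -EFinM lee_fin exprVn.
Qed.

Theorem theorem1p7 (R : realType) (d : nat) (alpha : 'I_d -> R)
    (q : \bar R) (r : 'I_d -> R)
    (alpha_gt0 : forall j, 0 < alpha j)
    (alpha_sum1 : \sum_(j < d) alpha j = 1)
    (q_ge2 : (2%:E <= q)%E)
    (r_ge2 : forall j, 2 <= r j) :
  exists C : R,
  forall (k : scalars)
    (dX : measure_display) (X : measurableType dX)
    (mu : {sigma_finite_measure set X -> \bar R})
    (dY : 'I_d -> measure_display) (Y : forall j, measurableType (dY j))
    (nu : forall j, {measure set (Y j) -> \bar R})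
    (T : forall j, (Y j -> scalar_field R k) -> (X -> scalar_field R k))
    (B : R),
  (forall j, linear_operator mu (simple_functions (nu j) (r j)%:E) (T j)) ->
  (forall j, saturates mu (simple_functions (nu j) (r j)%:E) (T j)) ->
  (forall f : forall j, Y j -> scalar_field R k,
     (forall j, simple_functions (nu j) (r j)%:E (f j)) ->
     (Lnorm mu q (fun x => (\prod_(j < d) modulus (T j (f j) x) `^ alpha j)%:E)
      <= B%:E * \prod_(j < d) (lpnorm (nu j) (r j)%:E (f j) `^ alpha j))%E) ->
  forall G : X -> R,
  (forall x, 0 <= G x) ->
  G \in Lfun mu (hoelder_conjugate (q / 2%:E)%E) ->
  exists g : 'I_d -> X -> R,
    [/\ forall j x, 0 <= g j x,
        forall j, measurable_fun setT (g j),
        {ae mu, forall x, G x <= \prod_(j < d) g j x `^ alpha j} &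
        forall j (f : Y j -> scalar_field R k),
          simple_functions (nu j) (r j)%:E f ->
          ((\int[mu]_x (modulus (T j f x) ^+ 2 * g j x)%:E) `^ 2^-1
           <= (C * B)%:E
              * Lnorm mu (hoelder_conjugate (q / 2%:E)) (EFin \o G) `^ 2^-1
              * lpnorm (nu j) (r j)%:E f)%E].
Proof.
have D_gt0 := duality_const_gt0 r.
pose inv_sum := \sum_j (alpha j)^-1.
have inv_le j : (alpha j)^-1 <= inv_sum.
  rewrite /inv_sum (bigD1 j)//= lerDl sumr_ge0// => i _.
  by rewrite invr_ge0 ltW.
exists (Num.sqrt (8 * duality_const r * inv_sum)).
move=> k dX X mu dY Y nu T B linT satT bound G G0 GL.
have mG : measurable_fun setT G by have := sub_Lfun_mfun GL; rewrite inE.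
have nG : (Lnorm mu (hoelder_conjugate (q / 2%:E)) (EFin \o G) < +oo)%E.
  by have := sub_Lfun_finLfun GL; rewrite inE.
set normG := Lnorm _ _ _ in nG *.
have conj_ge1 : (1 <= hoelder_conjugate (q / 2%:E))%E.
  apply: hoelder_conj_ge1; rewrite inver pnatr_eq0 /=.
  case: q q_ge2 {bound GL normG nG} => [q||]//; last first.
    by move=> _; rewrite gt0_mulye ?lte_fin// leey.
  by rewrite -EFinM !lee_fin => q2; lra.
have mG' : measurable_fun setT (EFin \o G) by exact/measurable_EFinP.
(* a null X belongs to the first case; in the second, B > 0 *)
have [nG0|nG_neq0] := eqVneq normG 0%E.
  have G_ae0 := Lnorm_eq0_eq0 mG' (lt_le_trans lte01 conj_ge1) nG0.
  exists (fun _ _ => 0); split => //.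
  - apply: filterS G_ae0 => x /(_ I) [->]; apply: prodr_ge0 => j _.
    exact: powR_ge0.
  - move=> j f Sf; under eq_integral do rewrite mulr0.
    by rewrite integral0 nG0 !poweR0r ?invr_neq0// mule0 mul0e.
have nG_gt0 : (0 < normG)%E by rewrite lt0e nG_neq0 Lnorm_ge0.
have mu_gt0 : (0 < mu setT)%E.
  rewrite lt0e measure_ge0 andbT; apply: contra nG_neq0 => /eqP mu0.
  by apply/eqP; exact: Lnorm_null.
have B_gt0 := multilinear_const_gt0 q_ge2 r_ge2 linT satT bound mu_gt0.
have [g [g0 mg Gg gM]] := factorizing_weights alpha_gt0 alpha_sum1 q_ge2 r_ge2
  linT satT bound B_gt0 mG G0 nG nG_gt0.
exists g; split => // j f Sf.
have r_ge1 i : 1 <= r i by have := r_ge2 i; lra.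
have r_gt0 i : 0 < r i by have := r_ge2 i; lra.
have nGE : normG = (fine normG)%:E by rewrite fineK// ge0_fin_numE// ltW.
have nG_fine : 0 < fine normG by rewrite fine_gt0// nG_gt0.
pose K := 8 * (duality_const r * B ^+ 2 * fine normG) / alpha j.
have K_gt0 : 0 < K by rewrite divr_gt0// pmulr_rgt0// mulr_gt0// mulr_gt0// exprn_gt0.
have unitK h : simple_functions (nu j) (r j)%:E h ->
    (\int[nu j]_y (modulus (h y) `^ r j)%:E <= 1)%E ->
    (\int[mu]_x (modulus (T j h x) ^+ 2 * g j x)%:E <= K%:E)%E.
  move=> Sh h1.
  (* a bound for one operator follows from tuples that vanish in the other
     coordinates *)
  pose a := @dfwith _ (fun i => Y i -> scalar_field R k) (fun i _ => 0) j h.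
  have ua : unit_ball_tuple r nu a.
    move=> i; rewrite /a; case: dfwithP => [|i' _]; first by split.
    split; first exact: simple_functions0.
    by rewrite integral0_eq// => y _; rewrite modulus0 powR0// gt_eqF.
  have := gM a ua j; rewrite /a dfwithin.
  by rewrite -lee_pdivlMl// -EFinM mulrC.
have := weighted_bound_homogeneous (r_ge1 j) (linT j) (g0 j) (mg j) K_gt0 unitK Sf.
move/le_trans; apply.
rewrite lee_wpmul2r ?Lnorm_ge0// nGE poweR_EFin -EFinM lee_fin.
rewrite powR12_sqrt ?(ltW nG_fine)//.
rewrite -[B in leRHS](ger0_norm (ltW B_gt0)) -sqrtr_sqr.
have D0 : 0 <= 8 * duality_const r * inv_sum.
  have S0 : 0 <= inv_sum by apply: sumr_ge0 => i _; rewrite invr_ge0 ltW.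
  by rewrite mulr_ge0// pmulr_rge0// ltW.
rewrite -sqrtrM// -sqrtrM ?(mulr_ge0 D0) ?sqr_ge0// ler_wsqrtr// /K.
rewrite (_ : 8 * _ / _ =
  8 * duality_const r * (alpha j)^-1 * B ^+ 2 * fine normG); last by ring.
rewrite ler_wpM2r ?(ltW nG_fine)// ler_wpM2r ?sqr_ge0// ler_wpM2l//.
by rewrite pmulr_rge0 ?(ltW D_gt0).
Qed.
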